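(* Let $M\geqslant4$, $\mathbb{P}=\mathbb{P}^M$, and let $\mathcal{W}=\mathbb{P}(H^0(\mathbb{P},\mathcal{O}_{\mathbb{P}}(2M)))$ be the space of hypersurfaces of degree $2M$ in $\mathbb{P}$. There is a Zariski open subset $\mathcal{W}_{\rm reg}\subset\mathcal{W}$ such that any hypersurface $W\in\mathcal{W}_{\rm reg}$ has finitely many singular points, each of which is a quadratic singularity of rank at least $3$, and, moreover, the following estimate holds: $$\operatorname{codim}\big((\mathcal{W}\setminus\mathcal{W}_{\rm reg})\subset\mathcal{W}\big)\geqslant\frac{(M-2)(M-1)}{2}+1.$$
   Context: The ground field is $\mathbb{C}$. A singular point $o$ of a hypersurface $W\subset\mathbb{P}^M$ is a quadratic singularity of rank at least $r$ if, in affine coordinates centred at $o$, $W$ is given by an equation $0=q_2+q_3+\dots$ with $q_i$ homogeneous of degree $i$ and $q_2$ a quadratic form of rank at least $r$. *)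

(* Defs.v *)
From HB Require Import structures.
From mathcomp Require Import all_boot all_order all_algebra.
From mathcomp Require Import mpoly complex.
From mathcomp Require Import boolp classical_sets functions cardinality reals.
Set Implicit Arguments.
Unset Strict Implicit.
Unset Printing Implicit Defensive.
Import GRing.Theory.
Local Open Scope classical_set_scope.
Local Open Scope ring_scope.

(* The points of P(V) are the lines of V through the origin. *)
Definition proj (K : fieldType) (V : vectType K) : Type :=
  {L : {vspace V} | \dim L == 1%N}.

Definition line_of (K : fieldType) (V : vectType K) (L : proj V) : {vspace V} :=
  sval L.

Section Zariski.
Variables (K : fieldType) (V : vectType K).
Implicit Types (Y Z U : set (proj V)).

(* Polynomial functions on V are polynomials in the coordinates with respect
   to a fixed basis; the closed sets do not depend on the choice of the basis. *)
Definition zero_locus (S : set {mpoly K[\dim {:V}]}) : set (proj V) :=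
  [set L | forall f, S f ->
     forall v : V, v \in line_of L -> f.@[fun i => coord (vbasis {:V}) i v] = 0].

Definition zariski_closed Z : Prop :=
  exists S : set {mpoly K[\dim {:V}]},
    (forall f, S f -> f \is homog mdeg) /\ Z = zero_locus S.

Definition zariski_open U : Prop := zariski_closed (~` U).

Definition irreducible_closed Y : Prop :=
  [/\ zariski_closed Y, Y !=set0 &
      forall Z1 Z2, zariski_closed Z1 -> zariski_closed Z2 ->
        Y = Z1 `|` Z2 -> Y = Z1 \/ Y = Z2].

(* codim (Z, P(V)) >= c for a closed subset Z: the codimension is the infimum,
   over the irreducible closed Y contained in Z, of the supremum of the lengths
   of the chains Y = Y_0 < Y_1 < ... < Y_n of irreducible closed subsets of
   P(V). In particular the empty set has infinite codimension. *)
Definition codim_ge Z (c : nat) : Prop :=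
  forall Y, irreducible_closed Y -> Y `<=` Z ->
  exists Y_ : nat -> set (proj V),
    [/\ Y_ 0%N = Y,
        forall i, (i <= c)%N -> irreducible_closed (Y_ i) &
        forall i, (i < c)%N -> Y_ i `<` Y_ i.+1].

End Zariski.

(* The rank of the quadratic form q, read off its symmetric Gram matrix
   (2 is assumed to be invertible in K). *)
Definition quadratic_form_rank (K : fieldType) (n : nat) (q : {mpoly K[n]}) :
    nat :=
  \rank (\matrix_(i < n, j < n)
    (if i == j then q@_(U_(i) *+ 2)%MM else q@_(U_(i) + U_(j))%MM / 2)).

Section Hypersurfaces.
Variables (K : fieldType) (M d : nat).

Definition projective_space : Type := proj 'rV[K]_M.+1.

(* P(H^0(P^M, O(d))): a hypersurface is a line spanned by a nonzero form of
   degree d in M + 1 variables. *)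
Definition hypersurface : Type := proj (dhomog M.+1 K d).

Implicit Types (W : hypersurface) (o : projective_space).

Definition singular_locus W : set projective_space :=
  [set o | forall F : dhomog M.+1 K d, F \in line_of W ->
     forall x : 'rV[K]_M.+1, x \in line_of o ->
     (F : {mpoly K[M.+1]}).@[x 0] = 0 /\
     forall i : 'I_M.+1, ((F : {mpoly K[M.+1]})^`M(i)).@[x 0] = 0].

(* The rows e_0, ..., e_M of an invertible matrix e define the affine chart
   (z_1, ..., z_M) |-> [e_0 + z_1 e_1 + ... + z_M e_M] centred at [e_0]; this
   is the equation of the hypersurface F = 0 in this chart. *)
Definition affine_equation (F : {mpoly K[M.+1]}) (e : 'M[K]_M.+1) :
    {mpoly K[M]} :=
  F \mPo [tuple (e ord0 j)%:MP + \sum_(i < M) e (lift ord0 i) j *: 'X_i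
         | j < M.+1].

Definition quadratic_singularity_rank_ge W o (r : nat) : Prop :=
  exists (F : dhomog M.+1 K d) (e : 'M[K]_M.+1),
    [/\ F \in line_of W /\ F != 0,
        e \in unitmx /\ row ord0 e \in line_of o,
        pihomog mdeg 0 (affine_equation F e) = 0,
        pihomog mdeg 1 (affine_equation F e) = 0 &
        (r <= quadratic_form_rank (pihomog mdeg 2 (affine_equation F e)))%N].

End Hypersurfaces.

(* Main.v *)
(** A hypersurface of degree [2M] is bad if it has a singular point of rank at
    most 2, or infinitely many singular points; [Wreg] is the complement of the
    Zariski closure of the set of bad hypersurfaces.

    The bad forms are covered by finitely many sets, each cut out by [q] linear
    conditions on the form that depend polynomially on [p] parameters and are
    independent for every relevant value of the parameters. By Cramer's rule such
    a set is covered by polynomial images of affine spaces of dimension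
    [N - q + p], where [N] is the dimension of the space of forms; so any more
    than [N - q + p] coordinates are algebraically dependent on it. An
    irreducible closed set [Y] on which any more than [N - c] coordinates are
    dependent starts a chain of length [c]: take a maximal independent set of
    coordinates and free the other coordinates one after the other.

    Rank at most 2: the Hessian at the point [x] kills an [(M-1)]-dimensional space
    containing [x]. Such flags have [3M - 4] parameters, and there are
    [(M+1)(M+2)/2 - 3] conditions, which gives exactly the stated bound.

    Infinitely many singular points: let [k + 1] be the least dimension of a
    subspace of [K^(M+1)] containing infinitely many of them. Then one finds
    [k(M-1)] singular points in it of which any [k + 1] are linearly independent.
    The double point conditions at such points are independent in degree [2M],
    since the points other than a given one fall into [M - 1] groups of at most
    [k], each of which lies on a hyperplane avoiding the given point. *)

Require Import Defs.
From HB Require Import structures.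
From mathcomp Require Import all_boot all_order all_algebra.
From mathcomp Require Import mpoly complex.
From mathcomp Require Import boolp classical_sets functions cardinality reals.
From mathcomp Require Import perm zify ring.
Set Implicit Arguments.
Unset Strict Implicit.
Unset Printing Implicit Defensive.
Import GRing.Theory.
Local Open Scope classical_set_scope.
Local Open Scope ring_scope.

(** * Polynomials over an infinite field *)

Section PolynomialFunctions.
Variables (K : numFieldType) (n : nat).
Implicit Types (f : {mpoly K[n]}) (a : 'I_n -> K).

Definition depends_on (T : {set 'I_n}) f : Prop :=
  forall a b, {in T, a =1 b} -> f.@[a] = f.@[b].

Lemma poly_eq0_horner (q : {poly K}) : (forall x, q.[x] = 0) -> q = 0.
Proof.
move=> q0; apply/eqP; apply: contraT => nz.
have := max_poly_roots nz (rs := [seq i%:R | i <- iota 0 (size q)]).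
rewrite size_map size_iota ltnn => H; apply: H.
  by apply/allP => x _; apply/rootP.
by rewrite map_inj_uniq ?iota_uniq // => i j /eqP; rewrite Num.Theory.eqr_nat => /eqP.
Qed.

Lemma base_expansion_inj (B k : nat) (a b : nat -> nat) :
  (forall i, a i < B)%N -> (forall i, b i < B)%N ->
  (\sum_(i < k) a i * B ^ i = \sum_(i < k) b i * B ^ i)%N ->
  forall i, (i < k)%N -> a i = b i.
Proof.
elim: k a b => // k IHk a b aB bB; rewrite !big_ord_recl !expn0 !muln1 => E.
have shift (c : nat -> nat) : (\sum_(i < k) c (bump 0 i) * B ^ bump 0 i =
    (\sum_(i < k) c i.+1 * B ^ i) * B)%N.
  by rewrite big_distrl /=; apply: eq_bigr => i _; rewrite /bump add1n expnSr mulnA.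
rewrite !shift in E.
have E0 : a 0%N = b 0%N.
  have := congr1 (modn^~ B) E.
  by rewrite /= ![(_ + _ * B)%N]addnC !modnMDl !modn_small.
case=> [//|i]; rewrite ltnS => ik; apply: (IHk (fun i => a i.+1) (fun i => b i.+1)) => //.
move: E; rewrite E0 => /addnI /eqP; rewrite eqn_pmul2r ?(leq_ltn_trans _ (aB 0%N)) //.
by move/eqP.
Qed.

(* Kronecker substitution [x_i := s ^ (B ^ i)] separates the monomials of f. *)
Lemma mpoly_eq0_meval f : (forall a, f.@[a] = 0) -> f = 0.
Proof.
move=> f0.
pose B := msize f.
pose w (m : 'X_{1..n}) := (\sum_(i < n) m i * B ^ i)%N.
have w_inj : {in msupp f &, injective w}.
  move=> m1 m2 s1 s2 E; apply/mnmP => i.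
  pose ext (m : 'X_{1..n}) k := if insub k is Some j then m (j : 'I_n) else 0%N.
  have extE m (j : 'I_n) : ext m j = m j.
    by rewrite /ext insubT //= => jn; congr (m _); apply: val_inj.
  have extB m : m \in msupp f -> forall k, (ext m k < B)%N.
    move=> /msize_mdeg_lt mf k; rewrite /ext; case: insubP => [j _ _|_].
      by apply: leq_ltn_trans mf; rewrite mdegE (bigD1 j) //= leq_addr.
    exact: leq_ltn_trans mf.
  rewrite -!extE; apply: (base_expansion_inj (extB _ s1) (extB _ s2) _ (ltn_ord i)).
  rewrite /w in E.
  by under eq_bigr do rewrite extE; under [RHS]eq_bigr do rewrite extE.
pose q : {poly K} := \sum_(m <- msupp f) f@_m *: 'X^(w m).
have q0 : q = 0.
  apply: poly_eq0_horner => x; rewrite -[RHS](f0 (fun i => x ^+ (B ^ i))).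
  rewrite mevalE /q horner_sum; apply: eq_bigr => m _.
  rewrite hornerZ hornerXn /w -prodrXr; congr (_ * _).
  by apply: eq_bigr => i _; rewrite mulnC exprM.
apply/mpolyP => m; rewrite mcoeff0; apply/eqP; rewrite mcoeff_eq0; apply/negP => mf.
have /eqP := congr1 (fun p : {poly K} => p`_(w m)) q0.
rewrite /q coef0 coef_sum (bigD1_seq m) //= coefZ coefXn eqxx mulr1.
rewrite big_seq_cond big1 ?addr0 => [|m' /andP[m'f m'm]].
  by rewrite mcoeff_eq0 mf.
rewrite coefZ coefXn; case: eqP => [/w_inj E|_]; last by rewrite mulr0.
by move/eqP: m'm; rewrite E.
Qed.

Lemma mcoeff_pihomog d f m : (pihomog mdeg d f)@_m = if mdeg m == d then f@_m else 0.
Proof.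
rewrite pihomogE raddf_sum /=.
under eq_bigr do rewrite mcoeffZ mcoeffX.
case: (boolP (m \in msupp f)) => mf.
  rewrite big_mkcond (bigD1_seq m) //= eqxx mulr1 big1 ?addr0 //.
  by move=> m' m'm; rewrite (negPf m'm) mulr0 if_same.
rewrite (memN_msupp_eq0 mf) if_same big_seq_cond big1 // => m' /andP[m'f _].
by case: eqP => [E|_]; [rewrite -E m'f in mf | rewrite mulr0].
Qed.

Lemma dhomog_mevalZ d f (c : K) a : f \is d.-homog ->
  f.@[fun i => c * a i] = c ^+ d * f.@[a].
Proof.
move=> /dhomogP hf; rewrite !mevalE mulr_sumr big_seq [RHS]big_seq.
apply: eq_bigr => m /hf /= <-; rewrite mulrCA; congr (_ * _).
rewrite (eq_bigr (fun i => c ^+ m i * a i ^+ m i)) => [|i _]; last by rewrite exprMn.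
by rewrite big_split /= prodrXr mdegE.
Qed.

(** Along the line through [a], [f] is a polynomial in [c] whose coefficients are the values at [a]
    of its homogeneous components. *)
Lemma meval_pihomog_eq0 f a : (forall c, f.@[fun i => c * a i] = 0) ->
  forall d, (pihomog mdeg d f).@[a] = 0.
Proof.
move=> f0 d.
pose q : {poly K} := \poly_(k < msize f) (pihomog mdeg k f).@[a].
have q0 : q = 0.
  apply: poly_eq0_horner => x; rewrite -[RHS](f0 x).
  rewrite [in RHS](@pihomog_partitionE _ _ mdeg (msize f) f) // raddf_sum /=.
  rewrite horner_poly; apply: eq_bigr => k _.
  by rewrite (@dhomog_mevalZ k) ?pihomogP // mulrC.
have := congr1 (fun p : {poly K} => p`_d) q0.
rewrite coef0 coef_poly; case: ifP => // /negbT; rewrite -leqNgt => sd _.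
suff -> : pihomog mdeg d f = 0 by rewrite meval0.
apply/mpolyP => m; rewrite mcoeff_pihomog mcoeff0; case: eqP => // md.
by apply/eqP; rewrite mcoeff_eq0; apply: msize_mdeg_ge; rewrite md.
Qed.

Lemma euler_identity d f a : f \is d.-homog ->
  \sum_i a i * (f^`M(i)).@[a] = d%:R * f.@[a].
Proof.
move=> /dhomogP hf; under eq_bigr do rewrite raddf_sum /= mulr_sumr.
rewrite exchange_big mevalE mulr_sumr big_seq [RHS]big_seq; apply: eq_bigr => m mf.
under eq_bigr do rewrite mevalZ mevalX.
rewrite mulrCA -(hf m mf) /= mdegE natr_sum mulr_suml mulr_sumr; apply: eq_bigr => i _.
have [-> | mi] := posnP (m i); first by rewrite !mul0r !mulr0.
rewrite [in RHS](bigD1 i) //= (bigD1 i) //= mnmBE mnm1E eqxx subn1.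
rewrite -[in RHS](prednK mi) exprS mulrA !mulrA.
rewrite [in LHS](eq_bigr (fun j => a j ^+ m j)); last first.
  by move=> j ji; rewrite mnmBE mnm1E eq_sym (negPf ji) subn0.
by congr (_ * _); rewrite prednK //; ring.
Qed.

End PolynomialFunctions.

(** * Chains of irreducible closed sets *)

Section Dimension.
Variables (K : numFieldType) (V : vectType K).
Local Notation N := (\dim {:V}).
Implicit Types (f g : {mpoly K[N]}) (u v w : V) (a b : 'I_N -> K).
Implicit Types (Y Z : set (proj V)) (T D : {set 'I_N}).

Definition crd v : 'I_N -> K := fun i => coord (vbasis {:V}) i v.
Definition of_crd a : V := \sum_i a i *: (vbasis {:V})`_i.

Lemma of_crdK a : crd (of_crd a) =1 a.
Proof. by move=> i; rewrite /crd coord_sum_free // (basis_free (vbasisP _)). Qed.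

Lemma crdK v : of_crd (crd v) = v.
Proof. by rewrite [RHS](coord_vbasis (memvf v)). Qed.

Lemma crdD u v i : crd (u + v) i = crd u i + crd v i.
Proof. by rewrite /crd raddfD. Qed.

Lemma crdZ (c : K) v i : crd (c *: v) i = c * crd v i.
Proof. by rewrite /crd linearZ. Qed.

Lemma crd0 i : crd 0 i = 0.
Proof. by rewrite /crd raddf0. Qed.

Lemma proj_of_dim1 v : v != 0 -> \dim <[v]>%VS == 1%N.
Proof. by move=> v0; rewrite dim_vline v0. Qed.

Definition proj_of v (v0 : v != 0) : proj V :=
  exist _ <[v]>%VS (proj_of_dim1 v0).

Lemma proj_gen (L : proj V) : exists2 v, v != 0 & line_of L = <[v]>%VS.
Proof.
case: L => L /= /eqP dL; exists (vpick L); rewrite /= ?vpick0 -?dimv_eq0 ?dL //.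
apply/esym/eqP; rewrite eqEdim -memvE memv_pick dim_vline vpick0 -dimv_eq0 dL //.
Qed.

Definition cone Y v : Prop := exists2 L, Y L & v \in line_of L.

Lemma coneZ Y (c : K) v : cone Y v -> cone Y (c *: v).
Proof. by case=> L YL vL; exists L => //; apply: memvZ. Qed.

Lemma zero_locusE (S : set {mpoly K[N]}) L :
  zero_locus S L <-> forall f, S f -> forall v, v \in line_of L -> f.@[crd v] = 0.
Proof. by []. Qed.

(** [zariski_closed] asks for homogeneous equations; a polynomial vanishes on a line exactly when
    all its homogeneous components do. *)
Lemma zariski_closed_zero_locus (S : set {mpoly K[N]}) : zariski_closed (zero_locus S).
Proof.
exists [set g | exists f d, S f /\ g = pihomog mdeg d f]; split.
  by move=> g [f [d [_ ->]]]; apply/homogP; exists d; apply: pihomogP.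
apply/seteqP; split => L /zero_locusE LS; apply/zero_locusE => f.
  move=> [g [d [Sg ->]]] v vL; apply: meval_pihomog_eq0 => c.
  rewrite -(LS g Sg (c *: v)) ?memvZ //; apply: meval_eq => i.
  by rewrite crdZ.
move=> Sf v vL; rewrite [f](@pihomog_partitionE _ _ mdeg (msize f) f) // raddf_sum /=.
by apply: big1 => d _; apply: LS vL; exists f, d.
Qed.

Lemma zariski_closedI Y (S : set {mpoly K[N]}) :
  zariski_closed Y -> zariski_closed (Y `&` zero_locus S).
Proof.
case=> S' [_ ->]; suff -> : zero_locus S' `&` zero_locus S = zero_locus (S' `|` S).
  exact: zariski_closed_zero_locus.
apply/seteqP; split => L; first by case=> h' h f [/h'|/h].
by move=> h; split => f Sf; apply: h; [left|right].
Qed.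

Lemma meval_line f a b :
  exists q : {poly K}, forall s, q.[s] = f.@[fun i => a i + s * b i].
Proof.
exists (\sum_(m <- msupp f) f@_m *: \prod_i ((a i)%:P + b i *: 'X) ^+ m i) => s.
rewrite horner_sum mevalE; apply: eq_bigr => m _; rewrite hornerZ horner_prod.
congr (_ * _); apply: eq_bigr => i _.
by rewrite horner_exp hornerD hornerC hornerZ hornerX [s * _]mulrC.
Qed.

Definition vanishes_on (B : set V) f : Prop := forall v, B v -> f.@[crd v] = 0.

Definition supported_in D u : Prop := forall i, i \notin D -> crd u i = 0.

(* The Zariski closure of the cone over Y with vertex P(supported_in D). *)
Definition cylinder_ideal D Y f : Prop :=
  forall v u, cone Y v -> supported_in D u -> f.@[crd (v + u)] = 0.

Definition cylinder D Y : set (proj V) := zero_locus (cylinder_ideal D Y).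

Lemma supported_in0 D : supported_in D 0.
Proof. by move=> i _; rewrite crd0. Qed.

Lemma cylinder_mono D D' Y : D \subset D' -> cylinder D Y `<=` cylinder D' Y.
Proof.
move=> DD' L + f fD'; apply=> v u Yv uD; apply: fD' => // i iD'; apply: uD.
by apply: contra iD'; apply: (fintype.subsetP DD').
Qed.

Lemma sub_cylinder D Y : Y `<=` cylinder D Y.
Proof.
move=> L YL f fD v vL; rewrite -[v]addr0; apply: fD; last exact: supported_in0.
by exists L.
Qed.

Lemma cylinder0 Y : zariski_closed Y -> cylinder finset.set0 Y = Y.
Proof.
case=> S [_ YS]; apply/seteqP; split; last exact: sub_cylinder.
move=> L LY; rewrite YS => f Sf; apply: LY => v u [L' YL' vL'] u0.
have -> : u = 0.
  by rewrite -[u]crdK /of_crd big1 // => i _; rewrite u0 ?finset.inE // scale0r.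
by rewrite addr0; move: YL'; rewrite YS; apply.
Qed.

(** The line of [v + u] lies in the cylinder, because [cone Y] and the vectors supported in [D] are
    stable under scaling. Nonemptiness of [Y] serves the case [v + u = 0], a vector that lies on
    every line. *)
Lemma vanishes_on_cylinder D Y f : Y !=set0 -> vanishes_on (cone (cylinder D Y)) f ->
  cylinder_ideal D Y f.
Proof.
move=> [L0 YL0] f0 v u Yv uD; have [->|w0] := eqVneq (v + u) 0.
  by apply: f0; exists L0; [apply: sub_cylinder | rewrite mem0v].
apply: f0; exists (proj_of w0); last exact: memv_line.
move=> g gD _ /= /vlineP[k ->]; rewrite scalerDr; apply: gD; first exact: coneZ.
by move=> i iD; rewrite crdZ uD ?mulr0.
Qed.

(** If [f1 * f2] vanishes on the cylinder, [Y] is the union of the closed sets [Y & A f1] and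
    [Y & A f2], where [A f] collects the lines [L] such that [f] vanishes on every translate of [L]
    by a vector supported in [D]. Irreducibility of [Y] then puts [f1] or [f2] into the cylinder
    ideal. *)
Lemma irreducible_cylinder D Y : irreducible_closed Y -> irreducible_closed (cylinder D Y).
Proof.
case=> clY neY irrY; split; first exact: zariski_closed_zero_locus.
  by case: neY => L YL; exists L; apply: sub_cylinder.
move=> Z1 Z2 [S1 [_ Z1E]] [S2 [_ Z2E]] DE.
apply: contrapT => /not_orP[n1 n2].
have wit S Z : Z = zero_locus S -> Z `<=` cylinder D Y -> cylinder D Y <> Z ->
    exists2 f, S f & ~ cylinder_ideal D Y f.
  move=> ZE ZY nZ; apply: contrapT => nf; apply: nZ; apply/seteqP; split => // L DL.
  rewrite ZE => f Sf; apply: DL; apply: contrapT => nD.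
  by apply: nf; exists f.
have [f1 Sf1 nf1] : exists2 f, S1 f & ~ cylinder_ideal D Y f.
  by apply: (wit _ Z1) => //; rewrite DE; left.
have [f2 Sf2 nf2] : exists2 f, S2 f & ~ cylinder_ideal D Y f.
  by apply: (wit _ Z2) => //; rewrite DE; right.
have f12 : cylinder_ideal D Y (f1 * f2).
  apply: vanishes_on_cylinder => // v [L]; rewrite DE Z1E Z2E mevalM.
  by case=> h vL; [rewrite (h _ Sf1 _ vL) mul0r | rewrite (h _ Sf2 _ vL) mulr0].
pose A f := zero_locus [set g | exists2 u, supported_in D u &
   g = f \mPo [tuple 'X_i + (crd u i)%:MP | i < N]].
have AE f L : A f L <-> forall v u, v \in line_of L -> supported_in D u -> f.@[crd (v + u)] = 0.
  have ev u v : (f \mPo [tuple 'X_i + (crd u i)%:MP | i < N]).@[crd v] = f.@[crd (v + u)].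
    rewrite comp_mpoly_meval; apply: meval_eq => i.
    by rewrite tnth_mktuple mevalD mevalXU mevalC crdD.
  split; first by move=> h v u vL uD; rewrite -ev; apply: h => //; exists u.
  by move=> h _ [u uD ->] v vL; rewrite ev; apply: h.
have YE : Y = (Y `&` A f1) `|` (Y `&` A f2).
  apply/seteqP; split => [L YL|L]; last by case=> -[].
  apply: contrapT => /not_orP[nA1 nA2].
  have {}nA1 : ~ A f1 L by move=> h; apply: nA1.
  have {}nA2 : ~ A f2 L by move=> h; apply: nA2.
  have nAE f : ~ A f L -> exists v u,
      [/\ v \in line_of L, supported_in D u & f.@[crd (v + u)] <> 0].
    move=> nA; apply: contrapT => h; apply: nA; apply/AE => v u vL uD.
    by apply: contrapT => fn; apply: h; exists v, u.
  have [v1 [u1 [v1L u1D E1]]] := nAE _ nA1.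
  have [v2 [u2 [v2L u2D E2]]] := nAE _ nA2.
  (* The line joining the two points stays in the linear space of all [v + u], on which [f1 * f2]
     vanishes; so one of the two restrictions to this line is zero, against [E1] or [E2]. *)
  pose b i := crd (v2 + u2) i - crd (v1 + u1) i.
  have [q1 q1E] := meval_line f1 (crd (v1 + u1)) b.
  have [q2 q2E] := meval_line f2 (crd (v1 + u1)) b.
  have q12 : q1 * q2 = 0.
    apply: poly_eq0_horner => s; rewrite hornerM q1E q2E -mevalM.
    rewrite -(f12 (v1 + s *: (v2 - v1)) (u1 + s *: (u2 - u1))).
    - apply: meval_eq => i; rewrite /b !crdD !crdZ !crdD -![- _ in RHS]scaleN1r !crdZ.
      ring.
    - by exists L => //; rewrite memvD // memvZ // memvB.
    move=> i iD; rewrite crdD crdZ crdD -scaleN1r crdZ u1D // u2D //; ring.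
  have /eqP := q12; rewrite mulf_eq0 => /orP[] /eqP q0.
    apply: E1; have := q1E 0; rewrite q0 horner0 => ->.
    by apply: meval_eq => i; rewrite mul0r addr0.
  apply: E2; have := q2E 1; rewrite q0 horner0 => ->.
  by apply: meval_eq => i; rewrite mul1r addrCA subrr addr0.
have fin f : ~ cylinder_ideal D Y f -> Y <> Y `&` A f.
  move=> nf E; apply: nf => v u [L YL vL] uD.
  by move: YL; rewrite E => -[_ /AE]; apply.
case: (irrY _ _ _ _ YE); rewrite /A; try exact: zariski_closedI.
  exact: fin.
exact: fin.
Qed.

(** The relation [f] does not involve the coordinates in [D], so it vanishes on the smaller
    cylinder. If it vanished on the larger one, fixing its [j]-th variable to any constant would
    give a relation in [T] alone, which is zero; then [f] itself would be zero. *)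
Lemma cylinder_proper D T (j : 'I_N) Y f : Y !=set0 ->
  {in D, forall i, i \notin T} -> j \notin D -> j \notin T ->
  (forall g, depends_on T g -> vanishes_on (cone Y) g -> g = 0) ->
  f != 0 -> depends_on (j |: T)%SET f -> vanishes_on (cone Y) f ->
  cylinder D Y `<` cylinder (j |: D)%SET Y.
Proof.
move=> neY dDT jD jT indT f0 fT fY; split; first exact/cylinder_mono/finset.subsetUr.
move=> sub; case/negP: f0; apply/eqP.
have fD : cylinder_ideal D Y f.
  move=> v u Yv uD; rewrite -(fY v Yv); apply: fT => i; rewrite in_setU1 => ijT.
  rewrite crdD uD ?addr0 //; case/orP: ijT => [/eqP->//|iT].
  by apply: contraL iT => /dDT.
have fjD : cylinder_ideal (j |: D)%SET Y f.
  by apply: vanishes_on_cylinder => // v [L /sub DL vL]; apply: DL vL.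
pose g (mu : K) := f \mPo [tuple if i == j then mu%:MP else 'X_i | i < N].
have gE mu a : (g mu).@[a] = f.@[fun i => if i == j then mu else a i].
  rewrite comp_mpoly_meval; apply: meval_eq => i; rewrite tnth_mktuple.
  by case: ifP => _; rewrite ?mevalC ?mevalXU.
have g0 mu : g mu = 0.
  apply: indT => [a b ab|v Yv].
    rewrite !gE; apply: fT => i; rewrite in_setU1; case: eqP => //= _; exact: ab.
  rewrite gE; pose e := of_crd (fun i => (i == j)%:R * (mu - crd v j)).
  rewrite -(fjD v e Yv) => [|i].
    apply: meval_eq => i; rewrite crdD of_crdK; case: eqP => [->|_].
      by rewrite mul1r addrCA subrr addr0.
    by rewrite mul0r addr0.
  by rewrite in_setU1 negb_or of_crdK => /andP[/negPf-> _]; rewrite mul0r.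
apply: mpoly_eq0_meval => a; have := gE (a j) a; rewrite g0 meval0 => ->.
by apply: meval_eq => i; case: eqP => [->|].
Qed.

Lemma irreducible_chain Y (c : nat) : irreducible_closed Y ->
  (forall T, (N < #|T| + c)%N ->
    exists f, [/\ f != 0, depends_on T f & vanishes_on (cone Y) f]) ->
  exists Y_ : nat -> set (proj V),
    [/\ Y_ 0%N = Y,
        forall i, (i <= c)%N -> irreducible_closed (Y_ i) &
        forall i, (i < c)%N -> Y_ i `<` Y_ i.+1].
Proof.
move=> irrY alg; have [clY neY _] := irrY.
pose indep T := `[< forall g, depends_on T g -> vanishes_on (cone Y) g -> g = 0 >].
have ind0 : indep finset.set0.
  apply/asboolP => g g0 gY; apply: mpoly_eq0_meval => a.
  case: neY => L YL; rewrite -(gY 0); last by exists L; rewrite ?mem0v.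
  by apply: g0 => i; rewrite finset.inE.
have [T /maxsetP[/asboolP indT maxT]] := ex_maxset (ex_intro (fun T => is_true (indep T)) _ ind0).
(* An independent set of more than [N - c] coordinates is excluded by [alg], so at least [c]
   coordinates are left to be freed. *)
have cT : (c <= size (enum (~: T)%SET))%N.
  rewrite -cardE cardsCs finset.setCK card_ord leq_subRL.
    rewrite leqNgt; apply/negP => /alg[f [f0 fT fY]].
    by rewrite (indT f) ?eqxx in f0.
  by rewrite -[leqRHS]card_ord max_card.
pose D k := [set i in take k (enum (~: T)%SET)]%SET.
exists (fun k => cylinder (D k) Y); split.
- rewrite -[RHS]cylinder0 //; congr cylinder.
  by apply/setP => i; rewrite !finset.inE /= take0.
- by move=> i _; apply: irreducible_cylinder.
move=> k kc; have ks := leq_trans kc cT.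
case E : (enum (~: T)%SET) => [|i0 s]; first by rewrite E in ks.
pose j := nth i0 (enum (~: T)%SET) k.
have uT := enum_uniq (~: T)%SET.
have -> : D k.+1 = (j |: D k)%SET.
  by apply/setP => i; rewrite !finset.inE (take_nth i0) // mem_rcons inE.
have jT : j \notin T.
  by have := mem_nth i0 ks; rewrite -/j mem_enum finset.inE.
have jD : j \notin D k.
  rewrite !finset.inE; apply/negP => jt.
  have := uT; rewrite -(cat_take_drop k (enum _)) cat_uniq => /and3P[_ /hasPn /(_ j) + _].
  by rewrite (drop_nth i0) // inE eqxx jt => /(_ isT).
(* By maximality of [T], adding [j] creates a nontrivial relation. *)
have [f [f0 fT fY]] : exists f, [/\ f != 0, depends_on (j |: T)%SET f & vanishes_on (cone Y) f].
  apply: contrapT => nf; case/negP: jT.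
  suff <- : (j |: T)%SET = T by rewrite setU11.
  apply: maxT; last exact: finset.subsetUr.
  apply/asboolP => g gT gY; apply/eqP; apply: contrapT => /negP g0.
  by apply: nf; exists g.
apply: (@cylinder_proper _ T _ _ f) => //.
by move=> i; rewrite finset.inE => /mem_take; rewrite mem_enum finset.inE.
Qed.

End Dimension.

(** * Algebraic dependence and polynomial maps *)

Section AlgebraicDependence.
Variable K : numFieldType.

Lemma msize_prod_le (n : nat) (I : finType) (P : I -> {mpoly K[n]}) (e : nat) :
  (forall i, msize (P i) <= e.+1)%N -> (msize (\prod_i P i) <= (#|I| * e).+1)%N.
Proof.
move=> Pe; rewrite cardE -big_enum; elim: (enum I) => [|i s IHs].
  by rewrite big_nil msize1.
rewrite big_cons /= mulSn; set p := P i; set q := \prod_(_ <- _) _.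
have [->|p0] := eqVneq p 0; first by rewrite mul0r msize0.
have [->|q0] := eqVneq q 0; first by rewrite mulr0 msize0.
rewrite msizeM //; have := Pe i; rewrite -/p.
by move: IHs; rewrite -/q; set x := msize _; set y := msize _; lia.
Qed.

Lemma msizeX_le (n : nat) (P : {mpoly K[n]}) (e k : nat) :
  (msize P <= e.+1)%N -> (msize (P ^+ k) <= (k * e).+1)%N.
Proof.
move=> Pe; have := @msize_prod_le n 'I_k (fun=> P) e (fun=> Pe).
by rewrite prodr_const card_ord.
Qed.

Lemma box_coef_eq0 (n E : nat) (P : {mpoly K[n]}) : (msize P <= E)%N ->
  (forall b : {ffun 'I_n -> 'I_E}, P@_[multinom (b i : nat) | i < n] = 0) -> P = 0.
Proof.
move=> PE P0; apply/mpolyP => m; rewrite mcoeff0.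
apply: contraTeq isT; rewrite -mcoeff_msupp => mP.
have mE i : (m i < E)%N.
  apply: leq_ltn_trans (leq_trans (msize_mdeg_lt mP) PE).
  by rewrite mdegE (bigD1 i) //= leq_addr.
move: mP; rewrite mcoeff_msupp -(P0 [ffun i => Ordinal (mE i)]) => /eqP[].
by congr (_@__); apply/mnmP => i; rewrite mnmE ffunE.
Qed.

(* There are D^k monomials of degree < D in each of k variables, but the values
   of all of them lie in a space of dimension O(D^n). *)
Lemma algebraic_dependence (n N : nat) (P : 'I_N -> {mpoly K[n]}) (T : {set 'I_N}) :
  (n < #|T|)%N ->
  exists F : {mpoly K[N]}, [/\ F != 0, depends_on T F &
    forall a, F.@[fun i => (P i).@[a]] = 0].
Proof.
(* A product of powers [P i ^+ a i] with [a i < D] has degree below [E], hence at most [E ^ n]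
   coefficients. Since [E <= D * (N * e + 1)] and [D > (N * e + 1) ^ n], this is less than
   [D ^ n.+1], so less than the number of exponents [a] supported in [T]. *)
move=> nT; pose e := (\max_i msize (P i))%N.
pose D' := ((N * e).+1 ^ n)%N; pose D := D'.+1; pose E := (N * (D * e)).+1.
pose S := [pred a : {ffun 'I_N -> 'I_D} | a \in pffun_on ord0 (mem T) predT].
pose mon (a : {ffun 'I_N -> 'I_D}) := [multinom (a i : nat) | i < N].
pose Q (a : {ffun 'I_N -> 'I_D}) := \prod_i P i ^+ a i.
have mon_inj : injective mon.
  move=> a b /mnmP ab; apply/ffunP => i; apply: val_inj.
  by have := ab i; rewrite !mnmE.
have QE a : (msize (Q a) <= E)%N.
  have := @msize_prod_le n 'I_N (fun i => P i ^+ a i) (D * e); rewrite card_ord; apply => i.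
  apply: leq_trans (msizeX_le (e := e) _ _) _; last by rewrite ltnS leq_mul2r ltnW ?orbT.
  by rewrite leqW // (leq_bigmax i).
pose A := \matrix_(i < #|S|, j < #|{ffun 'I_n -> 'I_E}|)
  (Q (enum_val i))@_[multinom ((enum_val j : {ffun 'I_n -> 'I_E}) l : nat) | l < n].
have : ~~ row_free A.
  rewrite /row_free neq_ltn (leq_ltn_trans (rank_leq_col A)) //.
  rewrite card_ffun !card_ord card_pffun_on cardT size_enum_ord.
  have EB : (E ^ n <= (D * (N * e).+1) ^ n)%N.
    by have [->//|n0] := posnP n; rewrite leq_exp2r // /E; nia.
  apply: leq_ltn_trans EB _; rewrite expnMn.
  apply: (@leq_trans (D ^ n.+1)); last by rewrite leq_exp2l // ltnS expn_gt0.
  by rewrite expnSr ltn_pmul2l ?expn_gt0 // /D ltnS.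
(* A row [v] of the left kernel is a linear relation among the products [Q a]; its entries become
   the coefficients of [F]. *)
rewrite -kermx_eq0 => /rowV0Pn[v /sub_kermxP vA v0].
exists (\sum_i v 0 i *: 'X_[mon (enum_val i)]); split.
- case/rV0Pn: v0 => i vi; apply/negP => /eqP /(congr1 (mcoeff (mon (enum_val i)))).
  rewrite mcoeff0 raddf_sum (bigD1 i) //= mcoeffZ mcoeffX eqxx mulr1 big1 ?addr0.
    by apply/eqP.
  move=> j ji; rewrite mcoeffZ mcoeffX (inj_eq mon_inj) (inj_eq enum_val_inj).
  by rewrite (negPf ji) mulr0.
- move=> a b ab; rewrite !raddf_sum; apply: eq_bigr => i _ /=.
  rewrite !mevalZ !mevalX; congr (_ * _); apply: eq_bigr => x _.
  have [xT|xT] := boolP (x \in T); first by rewrite ab.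
  have := enum_valP i; rewrite inE => /pffun_onP[/supportP /(_ x xT) + _].
  by rewrite mnmE => ->; rewrite !expr0.
have q0 : \sum_i v 0 i *: Q (enum_val i) = 0.
  apply: (@box_coef_eq0 _ E) => [|b].
    apply: leq_trans (mmeasure_sum _ _ _ _) _; apply/bigmax_leqP => i _.
    by apply: leq_trans (msizeZ_le _ _) (QE _).
  have /matrixP /(_ 0 (enum_rank b)) := vA; rewrite !mxE => <-.
  by rewrite raddf_sum; apply: eq_bigr => i _ /=; rewrite mcoeffZ !mxE enum_rankK.
move=> a; have := congr1 (meval a) q0; rewrite meval0 => <-.
rewrite !raddf_sum; apply: eq_bigr => i _ /=; rewrite !mevalZ; congr (_ * _).
rewrite mevalX rmorph_prod; apply: eq_bigr => j _ /=.
by rewrite mnmE rmorphXn.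
Qed.

End AlgebraicDependence.

(** * Polynomial functions of finitely many parameters *)

Section PolynomialMaps.
Variables (K : numFieldType) (I : finType).
Implicit Types (phi psi : (I -> K) -> K).

Definition polyfun phi : Prop :=
  exists P : {mpoly K[#|I|]}, forall t, phi t = P.@[t \o enum_val].

Lemma polyfun_ext phi psi : phi =1 psi -> polyfun psi -> polyfun phi.
Proof. by move=> E [P PE]; exists P => t; rewrite E. Qed.

Lemma polyfun_cst (c : K) : polyfun (fun=> c).
Proof. by exists c%:MP => t; rewrite mevalC. Qed.

Lemma polyfun_var (i : I) : polyfun (fun t => t i).
Proof. by exists 'X_(enum_rank i) => t; rewrite mevalXU /= enum_rankK. Qed.

Lemma polyfunD phi psi : polyfun phi -> polyfun psi -> polyfun (fun t => phi t + psi t).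
Proof. by move=> [P PE] [Q QE]; exists (P + Q) => t; rewrite PE QE mevalD. Qed.

Lemma polyfunM phi psi : polyfun phi -> polyfun psi -> polyfun (fun t => phi t * psi t).
Proof. by move=> [P PE] [Q QE]; exists (P * Q) => t; rewrite PE QE mevalM. Qed.

Lemma polyfunN phi : polyfun phi -> polyfun (fun t => - phi t).
Proof. by move=> [P PE]; exists (- P) => t; rewrite PE mevalN. Qed.

Lemma polyfun_sum (J : Type) (r : seq J) (p : pred J) (phi : J -> (I -> K) -> K) :
  (forall j, polyfun (phi j)) -> polyfun (fun t => \sum_(j <- r | p j) phi j t).
Proof.
move=> phiP; elim: r => [|j r IHr].
  by apply: polyfun_ext (polyfun_cst 0) => t; rewrite big_nil.
have [pj|pj] := boolP (p j).
  by apply: polyfun_ext (polyfunD (phiP j) IHr) => t; rewrite big_cons pj.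
by apply: polyfun_ext IHr => t; rewrite big_cons (negPf pj).
Qed.

Lemma polyfun_prod (J : Type) (r : seq J) (p : pred J) (phi : J -> (I -> K) -> K) :
  (forall j, polyfun (phi j)) -> polyfun (fun t => \prod_(j <- r | p j) phi j t).
Proof.
move=> phiP; elim: r => [|j r IHr].
  by apply: polyfun_ext (polyfun_cst 1) => t; rewrite big_nil.
have [pj|pj] := boolP (p j).
  by apply: polyfun_ext (polyfunM (phiP j) IHr) => t; rewrite big_cons pj.
by apply: polyfun_ext IHr => t; rewrite big_cons (negPf pj).
Qed.

Lemma polyfunX phi k : polyfun phi -> polyfun (fun t => phi t ^+ k).
Proof.
move=> phiP; apply: polyfun_ext (polyfun_prod (index_enum 'I_k) predT (fun=> phiP)) => t.
by rewrite prodr_const card_ord.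
Qed.

Lemma polyfun_meval n (f : {mpoly K[n]}) (phi : 'I_n -> (I -> K) -> K) :
  (forall i, polyfun (phi i)) -> polyfun (fun t => f.@[fun i => phi i t]).
Proof.
move=> phiP; apply: polyfun_ext (_ : polyfun (fun t =>
    \sum_(m <- msupp f) f@_m * \prod_i phi i t ^+ m i)) => [t|]; first by rewrite mevalE.
apply: polyfun_sum => m; apply: polyfunM; first exact: polyfun_cst.
by apply: polyfun_prod => i; apply: polyfunX.
Qed.

Lemma polyfun_mulmx (l n r : nat) (A : (I -> K) -> 'M[K]_(l, n)) (B : (I -> K) -> 'M[K]_(n, r)) :
  (forall i j, polyfun (fun t => A t i j)) -> (forall i j, polyfun (fun t => B t i j)) ->
  forall i j, polyfun (fun t => (A t *m B t) i j).
Proof.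
move=> AP BP i j; apply: polyfun_ext (_ : polyfun (fun t => \sum_k A t i k * B t k j)).
  by move=> t; rewrite mxE.
by apply: polyfun_sum => k; apply: polyfunM.
Qed.

Lemma polyfun_det n (A : (I -> K) -> 'M[K]_n) :
  (forall i j, polyfun (fun t => A t i j)) -> polyfun (fun t => \det (A t)).
Proof.
move=> AP; apply: polyfun_sum => s; apply: polyfunM; first exact: polyfun_cst.
exact: polyfun_prod.
Qed.

Lemma polyfun_adj n (A : (I -> K) -> 'M[K]_n) i j :
  (forall i j, polyfun (fun t => A t i j)) -> polyfun (fun t => (\adj (A t)) i j).
Proof.
move=> AP; apply: polyfun_ext (_ : polyfun (fun t => cofactor (A t) j i)) => [t|].
  by rewrite mxE.
apply: polyfunM; first exact: polyfun_cst.
apply: polyfun_det => k l.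
by apply: polyfun_ext (AP (lift j k) (lift i l)) => t; rewrite !mxE.
Qed.

Lemma polyfun_dependence N (phi : 'I_N -> (I -> K) -> K) (T : {set 'I_N}) :
  (forall i, polyfun (phi i)) -> (#|I| < #|T|)%N ->
  exists F : {mpoly K[N]}, [/\ F != 0, depends_on T F &
    forall t, F.@[fun i => phi i t] = 0].
Proof.
move=> /choice[P PE] IT; have [F [F0 FT FP]] := algebraic_dependence P IT.
exists F; split=> // t; rewrite -[RHS](FP (t \o enum_val)).
by apply: meval_eq => i; rewrite PE.
Qed.

End PolynomialMaps.

Lemma polyfun_comp (K : numFieldType) (I I' : finType) (s : I -> I')
    (phi : (I -> K) -> K) :
  polyfun phi -> polyfun (fun t : I' -> K => phi (t \o s)).
Proof.
move=> [P PE]; apply: polyfun_ext (polyfun_meval P (fun i => polyfun_var K (s (enum_val i)))).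
by move=> t; rewrite PE; apply: meval_eq.
Qed.

(** * Codimension of loci given by linear conditions *)

Section CodimensionCount.
Variables (K : numFieldType) (V : vectType K).
Local Notation N := (\dim {:V}).

(** An algebraic way to say that the closure of [B] has dimension at most [N - c], convenient
    because it passes to finite unions and to images of polynomial maps. *)
Definition codim_ge_alg (B : set V) (c : nat) : Prop :=
  forall T : {set 'I_N}, (N < #|T| + c)%N ->
  exists F : {mpoly K[N]}, [/\ F != 0, depends_on T F & vanishes_on B F].

(** The product of the relations found on the members is a relation on the union. *)
Lemma codim_ge_alg_bigcup (X : finType) (B : X -> set V) (c : nat) :
  (forall x, codim_ge_alg (B x) c) -> codim_ge_alg [set v | exists x, B x v] c.
Proof.
move=> Bc T NT; have [F FP] := choice (fun x => Bc x T NT).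
exists (\prod_x F x); split.
- by apply/prodf_neq0 => x _; case: (FP x).
- move=> a b ab; rewrite !rmorph_prod; apply: eq_bigr => x _ /=.
  by case: (FP x) => _ + _; apply.
move=> v [x Bv]; rewrite rmorph_prod (bigD1 x) //=.
by case: (FP x) => _ _ ->; rewrite ?mul0r.
Qed.

Lemma codim_ge_algU (B1 B2 : set V) (c : nat) :
  codim_ge_alg B1 c -> codim_ge_alg B2 c -> codim_ge_alg (B1 `|` B2) c.
Proof.
move=> c1 c2 T NT.
have [|F [F0 FT FB]] := @codim_ge_alg_bigcup bool (fun b => if b then B1 else B2) c _ T NT.
  by case.
by exists F; split=> // v [] Bv; apply: FB; [exists true | exists false].
Qed.

Lemma codim_ge_alg_sub (B1 B2 : set V) (c : nat) :
  B1 `<=` B2 -> codim_ge_alg B2 c -> codim_ge_alg B1 c.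
Proof.
move=> B12 Bc T /Bc[F [F0 FT FB]]; exists F; split=> // v /B12; exact: FB.
Qed.

Section LinearConditions.
Variables (I J : finType) (L : J -> (I -> K) -> V -> K).
Hypothesis L_linear : forall j t (a : K) u v, L j t (a *: u + v) = a * L j t u + L j t v.
Hypothesis L_poly : forall j v, polyfun (fun t => L j t v).

Let A (t : I -> K) : 'M[K]_(N, #|J|) :=
  \matrix_(b, j) L (enum_val j) t (vbasis {:V})`_b.

Let L_row t v j : L j t v = ((\row_i crd v i) *m A t) 0 (enum_rank j).
Proof.
have L0 : L j t 0 = 0.
  have := L_linear j t 1 0 0; rewrite scaler0 addr0 mul1r => /eqP.
  by rewrite -subr_eq subrr => /eqP.
rewrite -{1}[v]crdK /of_crd mxE.
elim/big_rec2: _ => // i x y _ E.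
by rewrite L_linear E !mxE enum_rankK.
Qed.

Definition independent_at t : Prop :=
  forall c : J -> K, (forall v, \sum_j c j * L j t v = 0) -> forall j, c j = 0.

Lemma independent_row_full t : independent_at t -> row_full (A t).
Proof.
move=> indt; rewrite /row_full -mxrank_tr; apply: inj_row_free => w wA.
apply/rowP => k; rewrite mxE -(enum_valK k).
apply: (indt (fun j => w 0 (enum_rank j))) => v.
transitivity (((\row_i crd v i) *m A t *m w^T) 0 0); last first.
  by rewrite -mulmxA -[A t *m _]trmxK trmx_mul trmxK wA trmx0 mulmx0 mxE.
rewrite mxE (reindex enum_rank); last exact/onW_bij/enum_rank_bij.
by apply: eq_bigr => j _; rewrite L_row [w^T _ _]mxE mulrC.
Qed.

(* On the chart where the minor of [A t] with rows [f] is invertible, Cramer's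
   rule recovers the kernel of [A t] from the coordinates outside [f]. *)
Lemma cramer_chart (f : {ffun 'I_#|J| -> 'I_N}) (c : nat) : injective f ->
  (c + #|I| <= #|J|)%N ->
  codim_ge_alg [set v | exists t, (forall j, L j t v = 0) /\ rowsub f (A t) \in unitmx] c.
Proof.
move=> f_inj cIJ T NT.
pose C := {i | i \notin codom f}.
have cardC : (#|{: C}| = N - #|J|)%N.
  have := cardC (mem (codom f)); rewrite card_codom // !card_ord card_sig => E.
  by rewrite -[X in (X - _)%N]E addKn; apply: eq_card => i; rewrite !inE.
have JN : (#|J| <= N)%N.
  by have := max_card (mem (codom f)); rewrite card_codom // !card_ord.
pose w (s : I + C -> K) : 'rV[K]_N := \row_i oapp (fun x : C => s (inr x)) 0 (insub i).
pose M (s : I + C -> K) := A (s \o inl).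
(* Cramer's formula for the coordinates in [f] in terms of the part [w] outside [f], multiplied
   through by the determinant so that it is polynomial in the parameters. *)
pose phi (s : I + C -> K) := \det (rowsub f (M s)) *: w s -
  w s *m M s *m \adj (rowsub f (M s)) *m \matrix_(k, l) (f k == l)%:R.
have Mpoly i j : polyfun (fun s => M s i j).
  apply: polyfun_ext (polyfun_comp inl (L_poly (enum_val j) (vbasis {:V})`_i)) => s.
  by rewrite mxE.
have Mfpoly i j : polyfun (fun s => (rowsub f (M s)) i j).
  by apply: polyfun_ext (Mpoly (f i) j) => s; rewrite mxE.
have wpoly i : polyfun (fun s => w s 0 i).
  apply: polyfun_ext (_ : polyfun (fun s => oapp (fun x : C => s (inr x)) 0 (insub i))).
    by move=> s; rewrite mxE.
  case: insubP => [x _ _|_] /=; [exact: polyfun_var | exact: polyfun_cst].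
have phipoly i : polyfun (fun s => phi s 0 i).
  apply: polyfun_ext (_ : polyfun (fun s => \det (rowsub f (M s)) * w s 0 i -
    (w s *m M s *m \adj (rowsub f (M s)) *m \matrix_(k, l) (f k == l)%:R) 0 i)).
    by move=> s; rewrite !mxE.
  apply: polyfunD; first by apply: polyfunM => //; apply: polyfun_det.
  apply: polyfunN; apply: (polyfun_mulmx (B := fun=> _)) => [i' j|k l]; last first.
    by apply: polyfun_ext (polyfun_cst _ _) => s; rewrite mxE.
  apply: polyfun_mulmx => [k l|k l]; last exact: polyfun_adj.
  by apply: polyfun_mulmx => // k' l'; rewrite [k']ord1.
(* There are [#|I| + (N - #|J|)] parameters, at most [N - c] and thus fewer than [#|T|]. *)
have [|F [F0 FT FP]] := polyfun_dependence (T := T) phipoly.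
  by rewrite card_sum cardC; lia.
exists F; split=> // v [t [Lv tu]].
pose d := \det (rowsub f (A t)).
have d0 : d != 0 by move: tu; rewrite unitmxE unitfE.
(* The free coordinates are divided by [d] beforehand, to compensate for the determinant in
   [phi]. *)
pose s (x : I + C) := match x with inl i => t i | inr i => d^-1 * crd v (val i) end.
rewrite -[RHS](FP s); apply: meval_eq => i.
pose r : 'rV[K]_N := \row_i crd v i.
have rA : r *m A t = 0.
  by apply/rowP => k; rewrite -(enum_valK k) -L_row Lv mxE.
pose E : 'M[K]_(#|J|, N) := \matrix_(k, l) (f k == l)%:R.
have EA : E *m A t = rowsub f (A t).
  apply/matrixP => k l; rewrite !mxE (bigD1 (f k)) //= mxE eqxx mul1r mxE.
  by rewrite big1 ?addr0 // => j jk; rewrite mxE eq_sym (negPf jk) mul0r.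
have wE : d *: w s = r - colsub f r *m E.
  apply/rowP => k; rewrite !mxE; case: insubP => [x xf <-|] /=.
    rewrite mulrA divff // mul1r big1 ?subr0 // => l _.
    rewrite !mxE; case: eqP => [fl|]; last by rewrite mulr0.
    by have := valP x; rewrite /= -fl codom_f.
  rewrite negbK mulr0 => /codomP[l ->]; rewrite (bigD1 l) //= !mxE eqxx mulr1.
  by rewrite big1 ?addr0 ?subrr // => m ml; rewrite !mxE (inj_eq f_inj) (negPf ml) mulr0.
have -> : crd v i = r 0 i by rewrite mxE.
suff -> : phi s = r by [].
have -> : phi s = d *: w s - w s *m A t *m \adj (rowsub f (A t)) *m E by [].
have wA : w s *m A t = - d^-1 *: (colsub f r *m rowsub f (A t)).
  apply: (scalerI d0); rewrite scalerA mulrN divff // scalemxAl wE mulmxBl rA sub0r.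
  by rewrite -mulmxA EA scaleN1r.
rewrite wA -!scalemxAl -[_ *m _ *m \adj _]mulmxA mul_mx_adj mul_mx_scalar -/d -scalemxAl.
by rewrite scalerA mulNr mulVf // wE scaleN1r opprK subrK.
Qed.

(** Independence at [t] makes some maximal minor of [A t] invertible; the finitely many choices [f]
    of its rows give a finite cover by Cramer charts. *)
Lemma codim_ge_alg_linear_conditions (c : nat) : (c + #|I| <= #|J|)%N ->
  codim_ge_alg [set v | exists t, (forall j, L j t v = 0) /\ independent_at t] c.
Proof.
move=> cIJ.
pose B (f : {ffun 'I_#|J| -> 'I_N}) := [set v | exists t, [/\ injective f,
  (forall j, L j t v = 0) & rowsub f (A t) \in unitmx]].
apply: (@codim_ge_alg_sub _ [set v | exists f, B f v]) => [v [t [Lv indt]]|].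
  have fA := independent_row_full indt.
  exists (fullrankfun fA), t; split=> //; first exact: fullrankfun_inj.
  exact: fullrowsub_unit.
apply: codim_ge_alg_bigcup => f; have [/injectiveP f_inj|f_inj] := boolP (injectiveb f).
  by apply: codim_ge_alg_sub (cramer_chart f_inj cIJ) => v [t [_ Lv tu]]; exists t.
(* For a non-injective [f] the set [B f] is empty, and the constant 1 is a relation on it. *)
move=> T _; exists 1; split=> [|a b _|v [t [/injectiveP]]].
- exact: oner_neq0.
- by rewrite !meval1.
by rewrite (negPf f_inj).
Qed.

End LinearConditions.
End CodimensionCount.

(** * Hessians and affine equations *)

(** A relation on [B] holds on its closure, hence on the cone over every [Y] inside it, and
    [irreducible_chain] applies. *)
Lemma codim_ge_closure (K : numFieldType) (V : vectType K) (B : set V) (c : nat) :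
  codim_ge_alg B c -> codim_ge (zero_locus [set f | vanishes_on B f]) c.
Proof.
move=> Bc Y irrY YZ; apply: irreducible_chain => // T /Bc[F [F0 FT FB]].
exists F; split=> // v [L YL vL]; exact: (YZ L YL) vL.
Qed.

(** A transposition corrects the value at the last index and, by injectivity, leaves the other
    values alone. This will move pivot columns to prescribed positions. *)
Lemma perm_extend (k : nat) (T : finType) (u v : 'I_k -> T) :
  injective u -> injective v -> exists s : {perm T}, forall a, s (u a) = v a.
Proof.
elim: k u v => [|k IHk] u v u_inj v_inj; first by exists 1%g => -[].
have [||s sE] := IHk (u \o lift ord_max) (v \o lift ord_max).
- by apply: inj_comp => //; apply: lift_inj.
- by apply: inj_comp => //; apply: lift_inj.
exists (s * tperm (s (u ord_max)) (v ord_max))%g => a; rewrite permM.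
case: (unliftP ord_max a) => [b|] ->; last by rewrite tpermL.
have /= E := sE b; rewrite E tpermD //.
  rewrite -E (inj_eq perm_inj) (inj_eq u_inj); exact: neq_lift.
by rewrite (inj_eq v_inj); apply: neq_lift.
Qed.

Section ChainRule.
Variables (K : numFieldType).

Lemma mpoly_ring_ind n (P : {mpoly K[n]} -> Prop) :
  (forall c, P c%:MP) -> (forall i, P 'X_i) ->
  (forall f g, P f -> P g -> P (f + g)) -> (forall f g, P f -> P g -> P (f * g)) ->
  forall f, P f.
Proof.
move=> PC PX PD PM f; rewrite [f]mpolyE; elim/big_rec: _ => [|m g _ Pg]; first exact: (PC 0).
apply: (PD) => //; rewrite -mul_mpolyC; apply: (PM) => //; rewrite mpolyXE_id.
elim/big_rec: _ => [|j h _ Ph]; first exact: (PC 1).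
apply: (PM) => //; elim: (m j) => [|a IHa]; first exact: (PC 1).
by rewrite exprS; apply: PM.
Qed.

Lemma mderiv_comp_mpoly n k (f : {mpoly K[n]}) (lq : n.-tuple {mpoly K[k]}) i :
  (f \mPo lq)^`M(i) = \sum_j (f^`M(j) \mPo lq) * (tnth lq j)^`M(i).
Proof.
pose P (f : {mpoly K[n]}) :=
  (f \mPo lq)^`M(i) = \sum_j (f^`M(j) \mPo lq) * (tnth lq j)^`M(i).
have PC c : P c%:MP.
  rewrite /P comp_mpolyC mderivC big1 // => j _.
  by rewrite mderivC comp_mpoly0 mul0r.
have PX l : P 'X_l.
  rewrite /P comp_mpolyXU (bigD1 l) //= big1 ?addr0 => [|j jl].
    rewrite mderivX mnm1E eqxx scale1r -{1}[U_(_)%MM]add0m addmK mpolyX0.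
    by rewrite comp_mpoly1 mul1r -tnth_nth.
  by rewrite mderivX mnm1E eq_sym (negPf jl) scale0r comp_mpoly0 mul0r.
have PD g h : P g -> P h -> P (g + h).
  rewrite /P => Pg Ph; rewrite comp_mpolyD mderivD Pg Ph -big_split /=.
  by apply: eq_bigr => j _; rewrite mderivD comp_mpolyD mulrDl.
have PM g h : P g -> P h -> P (g * h).
  rewrite /P => Pg Ph; rewrite rmorphM mderivM Pg Ph mulr_suml mulr_sumr -big_split /=.
  by apply: eq_bigr => j _; rewrite mderivM comp_mpolyD !rmorphM /=; ring.
exact: mpoly_ring_ind PC PX PD PM f.
Qed.

Lemma mcoeff0_meval n (f : {mpoly K[n]}) : f@_0 = f.@[fun=> 0].
Proof.
rewrite {1}[f]mpolyE mevalE raddf_sum; apply: eq_bigr => m _ /=.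
by rewrite mcoeffZ mcoeffX prodrXr -mdegE expr0n mdeg_eq0.
Qed.

End ChainRule.

Section Singularities.
Variables (K : numFieldType) (M d : nat).
Local Notation n := M.+1.
Implicit Types (F : {mpoly K[n]}) (x p : 'rV[K]_n) (e : 'M[K]_n).

Definition hessian F x : 'M[K]_n := \matrix_(i, j) (F^`M(i)^`M(j)).@[x 0].

Lemma hessian_sym F x : (hessian F x)^T = hessian F x.
Proof. by apply/matrixP => i j; rewrite !mxE mderiv_comm. Qed.

Lemma affine_equation_deriv F e i :
  (affine_equation F e)^`M(i) = \sum_j e (lift ord0 i) j *: affine_equation F^`M(j) e.
Proof.
rewrite mderiv_comp_mpoly; apply: eq_bigr => j _; rewrite tnth_mktuple.
rewrite mderivD mderivC add0r (raddf_sum (mderiv i)) /= (bigD1 i) //=.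
rewrite [X in _ + X]big1 ?addr0 => [|k ki]; last first.
  by rewrite mderivZ mderivX mnm1E (negPf ki) scale0r scaler0.
rewrite mderivZ mderivX mnm1E eqxx scale1r -{1}[U_(_)%MM]add0m addmK mpolyX0.
by rewrite -scalerAr mulr1.
Qed.

Lemma affine_equation_coef0 F e : (affine_equation F e)@_0 = F.@[e ord0].
Proof.
rewrite mcoeff0_meval comp_mpoly_meval; apply: meval_eq => j.
rewrite tnth_mktuple mevalD mevalC raddf_sum /= big1 ?addr0 // => i _.
by rewrite mevalZ mevalXU mulr0.
Qed.

Lemma affine_equation_coef1 F e i :
  (affine_equation F e)@_(U_(i)) = \sum_j e (lift ord0 i) j * (F^`M(j)).@[e ord0].
Proof.
have := mcoeff_mderiv i (affine_equation F e) 0.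
rewrite add0m mnm0E mulr1n => <-; rewrite affine_equation_deriv raddf_sum.
by apply: eq_bigr => j _ /=; rewrite mcoeffZ affine_equation_coef0.
Qed.

(** Both sides are a second partial derivative at the origin of the chart, which is twice the
    coefficient of a square and once that of a mixed monomial; hence the factor on the left. *)
Lemma affine_equation_coef2 F e i j :
  (affine_equation F e)@_(U_(i) + U_(j)) *+ (i == j).+1 =
  (row' ord0 e *m hessian F (row ord0 e) *m (row' ord0 e)^T) i j.
Proof.
have := mcoeff_mderiv j (affine_equation F e)^`M(i) 0.
rewrite add0m mnm0E mulr1n [in RHS]mcoeff_mderiv mnm1E addmC eq_sym => <-.
rewrite affine_equation_deriv (raddf_sum (mderiv j)) (raddf_sum (mcoeff 0%MM)) mxE.
under [RHS]eq_bigr => k _ do rewrite mxE mulr_suml.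
rewrite [RHS]exchange_big /=; apply: eq_bigr => k _.
rewrite mderivZ mcoeffZ affine_equation_deriv (raddf_sum (mcoeff 0%MM)) mulr_sumr.
apply: eq_bigr => l _ /=.
rewrite mcoeffZ affine_equation_coef0 !mxE -mulrA; congr (_ * _).
rewrite mulrC; congr (_ * _); apply: meval_eq => a; by rewrite mxE.
Qed.

End Singularities.

Section QuadraticSingularities.
Variables (K : numFieldType) (M d : nat).
Local Notation n := M.+1.
Implicit Types (p : 'rV[K]_n) (A : 'M[K]_M) (h : 'I_n).

(** The Gram matrix of the quadratic part is half the Hessian restricted to the span of the rows of
    [e] after the first; the lower terms vanish because the point is singular. *)
Lemma quadratic_singularity_rank_geI (W : hypersurface K M d) (o : projective_space K M)
    (F : dhomog n K d) (e : 'M[K]_n) (r : nat) :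
  F \in line_of W -> F != 0 -> e \in unitmx -> row ord0 e \in line_of o ->
  singular_locus W o ->
  (r <= \rank (row' ord0 e *m hessian F (row ord0 e) *m (row' ord0 e)^T))%N ->
  quadratic_singularity_rank_ge W o r.
Proof.
move=> FW F0 eu eo sing rG; exists F, e; have [Fe dFe] := sing F FW _ eo.
have rowe : row ord0 e 0 =1 e ord0 by move=> j; rewrite mxE.
split=> //.
- apply/mpolyP => m; rewrite mcoeff_pihomog mcoeff0; case: eqP => // /eqP.
  by rewrite mdeg_eq0 => /eqP ->; rewrite affine_equation_coef0 -(meval_eq _ rowe).
- apply/mpolyP => m; rewrite mcoeff_pihomog mcoeff0; case: eqP => // /eqP/mdeg1P[i /eqP ->].
  rewrite affine_equation_coef1 big1 // => j _.
  by rewrite -(meval_eq _ rowe) dFe mulr0.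
rewrite /quadratic_form_rank; set G := (X in \rank X).
suff -> : G = 2^-1 *: (row' ord0 e *m hessian F (row ord0 e) *m (row' ord0 e)^T).
  by rewrite mxrank_scale_nz // invr_eq0 Num.Theory.pnatr_eq0.
apply/matrixP => i j; rewrite [RHS]mxE -affine_equation_coef2 mxE !mcoeff_pihomog.
rewrite mdegMn mdegD !mdeg1 eqxx; case: (eqVneq i j) => [<-|_] /=.
  rewrite mulmS mulm1n -[X in _ = _ * X]mulr_natr mulrC mulfK //.
  by rewrite Num.Theory.pnatr_eq0.
by rewrite mulr1n mulrC.
Qed.

Definition unit_rows (h : 'I_n) : 'M[K]_(M, n) := row' h 1%:M.

(** The rows after the first lie in the coordinate hyperplane [x_h = 0], which misses [p] as soon as
    [p 0 h != 0]. *)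
Definition frame (p : 'rV[K]_n) (A : 'M[K]_M) (h : 'I_n) : 'M[K]_n :=
  col_mx p (A *m unit_rows h) : 'M[K]_(1 + M, n).

Lemma unit_rows_mul_tr h : unit_rows h *m (unit_rows h)^T = 1%:M :> 'M[K]_M.
Proof.
apply/matrixP => i j; rewrite !mxE (bigD1 (lift h i)) //= !mxE eqxx mul1r.
rewrite (inj_eq lift_inj) eq_sym big1 ?addr0 // => k ki.
by rewrite !mxE eq_sym (negPf ki) mul0r.
Qed.

Lemma frame_unit p A h : p 0 h != 0 -> A \in unitmx -> frame p A h \in unitmx.
Proof.
move=> ph0 Au; rewrite -row_free_unit; apply: inj_row_free => v.
change ((v : 'M_(1, 1 + M)) *m col_mx p (A *m unit_rows h) = 0 -> v = 0 :> 'M_(1, 1 + M)).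
move: (v : 'M_(1, 1 + M)) => {}v; rewrite -[v]hsubmxK mul_row_col => E.
have v0 : lsubmx v = 0.
  have /matrixP/(_ 0 h) := E; rewrite !mxE big_ord1.
  rewrite [X in _ + X]big1 ?addr0 => [/eqP|k _].
    rewrite mulf_eq0 (negPf ph0) orbF => /eqP v0.
    by apply/matrixP => i j; rewrite (ord1 i) (ord1 j) v0 mxE.
  rewrite !mxE big1 ?mulr0 // => l _.
  by rewrite !mxE eq_sym (negPf (neq_lift _ _)) mulr0.
move: E; rewrite v0 mul0mx add0r => E.
suff -> : rsubmx v = 0 by rewrite row_mx0.
have := congr1 (fun X => X *m (unit_rows h)^T *m invmx A) E.
by rewrite !mul0mx !mulmxA -[_ *m (unit_rows _)^T]mulmxA unit_rows_mul_tr mulmx1 mulmxK.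
Qed.

Lemma row_frame0 p A h : row ord0 (frame p A h) = p.
Proof.
apply/rowP => j; rewrite mxE /frame.
have -> : (ord0 : 'I_n) = lshift M (ord0 : 'I_1) by apply: val_inj.
exact: (col_mxEu p (A *m unit_rows h)).
Qed.

Lemma row'_frame0 p A h : row' ord0 (frame p A h) = A *m unit_rows h.
Proof.
apply/matrixP => i j; rewrite mxE /frame.
have -> : lift (ord0 : 'I_n) i = rshift 1 i by apply: val_inj.
exact: (col_mxEd p (A *m unit_rows h)).
Qed.

End QuadraticSingularities.

(** * The locus of singularities of rank at most two *)

Section LinearForms.
Variables (K : numFieldType) (n : nat).
Implicit Types (l : 'cV[K]_n) (x : 'rV[K]_n) (f : {mpoly K[n]}).

Definition linear_form l : {mpoly K[n]} := \sum_i l i 0 *: 'X_i.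

Lemma meval_linear_form l x : (linear_form l).@[x 0] = (x *m l) 0 0.
Proof.
rewrite raddf_sum mxE; apply: eq_bigr => i _ /=.
by rewrite mevalZ mevalXU mulrC.
Qed.

Lemma mderiv_linear_form l i : (linear_form l)^`M(i) = (l i 0)%:MP.
Proof.
rewrite (raddf_sum (mderiv i)) (bigD1 i) //= big1 ?addr0 => [|k ki].
  rewrite mderivZ mderivX mnm1E eqxx scale1r -{1}[U_(_)%MM]add0m addmK mpolyX0.
  by rewrite -mul_mpolyC mulr1.
by rewrite mderivZ mderivX mnm1E (negPf ki) scale0r scaler0.
Qed.

Lemma linear_form_homog l : linear_form l \is 1.-homog.
Proof. by apply: rpred_sum => i _; apply: rpredZ; rewrite dhomogX /= mdeg1. Qed.

Lemma mderivXn f k i : (f ^+ k.+1)^`M(i) = k.+1%:R * f ^+ k * f^`M(i).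
Proof.
elim: k => [|k IHk]; first by rewrite expr1 expr0 !mul1r.
rewrite exprS mderivM IHk exprS -[k.+2]addn1 natrD; ring.
Qed.

End LinearForms.

Lemma hessian_linear_form_exp (K : numFieldType) (M k : nat) (l : 'cV[K]_M.+1) (x : 'rV[K]_M.+1) :
  hessian (linear_form l ^+ k.+2) x =
  ((k.+2 * k.+1)%:R * (x *m l) 0 0 ^+ k) *: (l *m l^T).
Proof.
apply/matrixP => i j; rewrite !mxE big_ord1 !mxE mderivXn mderiv_linear_form.
rewrite -mulrA mderivM -[k.+2%:R]mpolyC_nat mderivC mul0r add0r mderivM mderivC mulr0 addr0.
rewrite mderivXn mderiv_linear_form !rmorphM /= !mevalC rmorphXn /= meval_linear_form.
rewrite -[k.+1%:R]mpolyC_nat mevalC natrM mxE; ring.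
Qed.

Section RankTwoLocus.
Variables (K : numFieldType) (m d : nat).
Hypothesis d_ge2 : (2 <= d)%N.
Local Notation M := m.+2.
Local Notation n := M.+1.
Local Notation I := ('I_M + 'I_m * 'I_2)%type.

Implicit Types (h : 'I_n) (s : {perm 'I_M}) (t : I -> K).

Definition chart_point h t : 'rV[K]_n :=
  \row_j oapp (fun k => t (inl k)) 1 (unlift h j).

Definition chart_block t : 'M[K]_M :=
  block_mx 1%:M 0 (\matrix_(a, b) t (inr (a, b))) 1%:M : 'M_(2 + m).

(* Row 0 is the singular point; rows 0 and 3, ..., M span a subspace of the kernel
   of the Hessian, in echelon form up to the choice of [h] and [s]. *)
Definition chart_frame h s t : 'M[K]_n :=
  frame (chart_point h t) (chart_block t *m perm_mx s) h.

(** Positions on or above the diagonal where the Hessian, written in the frame, must vanish if rows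
    0, 3, ..., M lie in its kernel: all except (1,1), (1,2) and (2,2). *)
Definition flag_pair : Type :=
  {x : 'I_n * 'I_n | (x.1 <= x.2)%N && ~~ ((0 < x.1)%N && (x.2 <= 2)%N)}.
HB.instance Definition _ := Finite.on flag_pair.

Definition hessian_condition h s (j : flag_pair) t (F : dhomog n K d) : K :=
  (chart_frame h s t *m hessian F (chart_point h t) *m (chart_frame h s t)^T)
    (val j).1 (val j).2.

(** Counted by the second index [b]: one pair for each [b <= 2] and [b + 1] pairs for each larger
    [b], in total [3 + m (m + 7) / 2], against [3 m + 2] parameters. The bound is in fact an
    equality. *)
Lemma card_flag_pair : (m * m.+1 %/ 2 + 1 + #|{: I}| <= #|{: flag_pair}|)%N.
Proof.
rewrite card_sum card_prod !card_ord.
have -> : #|{: flag_pair}| = (\sum_(b < n) \sum_(a < n)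
    ((a <= b)%N && ~~ ((0 < a)%N && (b <= 2)%N)))%N.
  rewrite card_sig -sum1_card big_mkcond exchange_big /=.
  rewrite pair_bigA /=; apply: eq_bigr => -[a b] _ /=.
  by rewrite inE /=; case: ifP.
have row_eq (b : 'I_n) : (2 < b)%N ->
    (\sum_(a < n) ((a <= b)%N && ~~ ((0 < a)%N && (b <= 2)%N)) = b.+1)%N.
  move=> b2; under eq_bigr => a _ do rewrite (leqNgt b) b2 andbF andbT.
  rewrite (eq_bigr (fun a : 'I_n => if (a < b.+1)%N then 1%N else 0%N)); last first.
    by move=> a _; rewrite ltnS; case: ifP.
  by rewrite -big_mkcond (big_ord_narrow (ltn_ord b)) sum1_card card_ord.
have tail : ((\sum_(b < m) (b + 4)) * 2 = m * (m + 7))%N.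
  by elim: (m) => [|k IHk]; rewrite ?big_ord0 // big_ord_recr /= mulnDl IHk; lia.
rewrite !big_ord_recl /=.
rewrite [X in (_ <= _ + (_ + (_ + X)))%N](eq_bigr (fun i : 'I_m => i + 4)%N) => [|i _]; last first.
  have E := row_eq (lift ord0 (lift ord0 (lift ord0 i))) isT.
  by rewrite [LHS]E /= /bump /=; lia.
have := divn_eq (m * m.+1) 2; rewrite modn2 oddM /= andbN.
set q := (_ %/ 2)%N; move: tail; set r := (\sum_(b < m) (b + 4))%N.
rewrite !big1 //; lia.
Qed.

Lemma chart_block_unit t : chart_block t \in unitmx.
Proof.
rewrite unitmxE /chart_block (@det_lblock _ 2 m) !det1 mulr1; exact: unitr1.
Qed.

Lemma chart_point_coord h t : chart_point h t 0 h = 1.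
Proof. by rewrite mxE unlift_none. Qed.

Lemma chart_frame_unit h s t : chart_frame h s t \in unitmx.
Proof.
apply: frame_unit; first by rewrite chart_point_coord oner_neq0.
by rewrite unitmx_mul chart_block_unit unitmx_perm.
Qed.

Lemma hessianP (a : K) (u v : dhomog n K d) x :
  hessian (a *: u + v : dhomog n K d) x = a *: hessian u x + hessian v x.
Proof.
by apply/matrixP => i j; rewrite !mxE /= !mderivD !mderivZ mevalD mevalZ.
Qed.

Lemma hessian_condition_linear h s j t a u v :
  hessian_condition h s j t (a *: u + v) =
  a * hessian_condition h s j t u + hessian_condition h s j t v.
Proof.
by rewrite /hessian_condition hessianP mulmxDr mulmxDl -scalemxAr -scalemxAl !mxE.
Qed.

Lemma polyfun_chart_point h j : polyfun (fun t => chart_point h t 0 j).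
Proof.
apply: polyfun_ext (_ : polyfun (fun t => oapp (fun k => t (inl k)) 1 (unlift h j))).
  by move=> t; rewrite mxE.
by case: (unlift h j) => [k|] /=; [apply: polyfun_var | apply: polyfun_cst].
Qed.

Lemma polyfun_chart_block i j : polyfun (fun t => chart_block t i j).
Proof.
have P : polyfun (fun t => match fintype.split (i : 'I_(2 + m)), fintype.split (j : 'I_(2 + m)) with
  | inl a, inl b => (a == b)%:R
  | inl _, inr _ => 0
  | inr a, inl b => t (inr (a, b))
  | inr a, inr b => (a == b)%:R end).
  case: (fintype.split _) => a; case: (fintype.split _) => b; try exact: polyfun_cst.
  exact: polyfun_var.
apply: polyfun_ext P => t; rewrite /chart_block /block_mx /col_mx mxE.
by case: (fintype.split _) => a; rewrite mxE; case: (fintype.split _) => b; rewrite ?mxE.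
Qed.

Lemma polyfun_chart_frame h s i j : polyfun (fun t => chart_frame h s t i j).
Proof.
rewrite /chart_frame /frame /col_mx.
apply: polyfun_ext (_ : polyfun (fun t => match fintype.split (i : 'I_(1 + M)) with
  | inl i => chart_point h t i j
  | inr i => (chart_block t *m perm_mx s *m unit_rows K h) i j end)) => [t|].
  by rewrite mxE.
case: (fintype.split _) => a; first by rewrite (ord1 a); apply: polyfun_chart_point.
apply: (polyfun_mulmx (B := fun=> _)) => [k l|k l]; last exact: polyfun_cst.
apply: (polyfun_mulmx (B := fun=> _)) => [k' l'|k' l']; last exact: polyfun_cst.
exact: polyfun_chart_block.
Qed.

Lemma polyfun_hessian_condition h s j F : polyfun (fun t => hessian_condition h s j t F).
Proof.
apply: polyfun_mulmx => [i k|i k].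
  apply: polyfun_mulmx => [i' k'|i' k']; first exact: polyfun_chart_frame.
  apply: polyfun_ext (_ : polyfun (fun t => (F^`M(i')^`M(k')).@[fun l => chart_point h t 0 l])).
    by move=> t; rewrite mxE.
  by apply: polyfun_meval => l; apply: polyfun_chart_point.
apply: polyfun_ext (polyfun_chart_frame h s k i) => t; by rewrite mxE.
Qed.

Lemma mnm_pair_inj (a b a' b' : 'I_n) : (a <= b)%N -> (a' <= b')%N ->
  (U_(a) + U_(b))%MM = (U_(a') + U_(b'))%MM -> (a, b) = (a', b').
Proof.
move=> ab ab' /mnmP E.
have := (E a, E b, E a', E b'); rewrite !mnmDE !mnm1E !eqxx.
rewrite (eq_sym b a) (eq_sym a' a) (eq_sym b' a) (eq_sym a' b) (eq_sym b' b) (eq_sym b' a').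
case: (eqVneq a a') => [<-|aa']; case: (eqVneq b b') => [<-|bb'] //=.
- by case: (a == b') => -[[[]]].
- by case: (a == b) => -[[[]]].
move=> -[[[E1 E2] _] _].
have ab'E : a = b' by move: E1; case: (a =P b') => // _; case: (a == b).
have ba'E : b = a' by move: E2; case: (b =P a') => // _; case: (a == b).
by move: aa'; rewrite -ba'E -val_eqE /= eqn_leq ab ba'E ab'E ab'.
Qed.

(* Tested against the powers of linear forms, whose Hessian at the point [p] is
   a multiple of the square of the form. *)
Lemma hessian_condition_independent h s t :
  independent_at (hessian_condition h s) t.
Proof.
move=> c c0.
pose f : {mpoly K[n]} := \sum_(j : flag_pair) c j *: 'X_[U_((val j).1) + U_((val j).2)].
have f0 : f * 'X_ord0 ^+ d.-2 = 0.
  (* [l] is chosen to take the values [a i] on the rows of the frame. On the form [l^d], the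
     condition at position [(x, y)] is then [k a_0^(d-2) a_x a_y], with a nonzero constant [k]
     independent of the position. *)
  apply: mpoly_eq0_meval => a; pose l := invmx (chart_frame h s t) *m \col_i a i.
  have dE : d = d.-2.+2 by case: (d) d_ge2 => [|[|]].
  have lP : linear_form l ^+ d \is d.-homog.
    by rewrite -{2}[d]mul1n dhomogMn // linear_form_homog.
  have el : chart_frame h s t *m l = \col_i a i by rewrite mulKVmx // chart_frame_unit.
  have pl : (chart_point h t *m l) 0 0 = a ord0.
    rewrite -[chart_point h t](row_frame0 _ (chart_block t *m perm_mx s) h).
    by rewrite -row_mul el !mxE.
  have := hessian_linear_form_exp d.-2 l (chart_point h t); rewrite -dE pl => hE.
  pose k : K := (d * d.-2.+1)%:R; have k0 : k != 0.
    by rewrite Num.Theory.pnatr_eq0 muln_eq0 negb_or andbT {1}dE.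
  apply: (mulfI k0); rewrite mulr0 -[RHS](c0 (DHomog lP)) mevalM rmorphXn /= mevalXU.
  rewrite raddf_sum mulr_suml mulr_sumr; apply: eq_bigr => j _ /=.
  rewrite /hessian_condition /= hE -scalemxAr -scalemxAl mulmxA el -mulmxA -trmx_mul el.
  rewrite mevalZ mevalX !mxE big_ord1 !mxE -/k.
  rewrite (eq_bigr (fun i => a i ^+ (U_((val j).1)%MM i) *
    a i ^+ (U_((val j).2)%MM i))); last first.
    by move=> i _; rewrite mnmDE exprD.
  have prodU b : \prod_i a i ^+ U_(b)%MM i = a b.
    rewrite (bigD1 b) //= mnm1E eqxx expr1 big1 ?mulr1 // => i ib.
    by rewrite mnm1E eq_sym (negPf ib) expr0.
  by rewrite big_split /= !prodU; ring.
have {}f0 : f = 0.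
  have /eqP := f0; rewrite mulf_eq0 expf_eq0 => /orP[/eqP//|/andP[_ /eqP X0]].
  have /eqP := congr1 (meval (fun=> 1 : K)) X0.
  by rewrite mevalXU meval0 oner_eq0.
move=> j; have := congr1 (mcoeff (U_((val j).1) + U_((val j).2))%MM) f0.
rewrite mcoeff0 raddf_sum (bigD1 j) //= mcoeffZ mcoeffX eqxx mulr1 big1 ?addr0 // => j' j'j.
rewrite mcoeffZ mcoeffX; case: eqP => [E|]; last by rewrite mulr0.
case/negP: j'j; apply/eqP/val_inj; have /andP[le1 _] := valP j; have /andP[le2 _] := valP j'.
move: (mnm_pair_inj le2 le1 E); by case: (val j') => ? ?; case: (val j).
Qed.

Definition rank_two_chart h s : set (dhomog n K d) :=
  [set F | exists t, forall j, hessian_condition h s j t F = 0].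

Lemma codim_rank_two_chart h s : codim_ge_alg (rank_two_chart h s) (m * m.+1 %/ 2 + 1).
Proof.
apply: codim_ge_alg_sub (codim_ge_alg_linear_conditions (hessian_condition_linear h s)
  (polyfun_hessian_condition h s) card_flag_pair) => F [t Ft].
by exists t; split=> //; apply: hessian_condition_independent.
Qed.

End RankTwoLocus.

Lemma dhomog_mderiv (K : numFieldType) n d (f : {mpoly K[n]}) i :
  f \is d.-homog -> f^`M(i) \is d.-1.-homog.
Proof.
move=> hf; apply/dhomogP => m; rewrite mcoeff_msupp mcoeff_mderiv => fm.
suff /= : mdeg (m + U_(i)) = d by rewrite mdegD mdeg1 addn1 => <-.
apply/eqP; apply: contraNT fm => /(dhomog_nemf_coeff hf) ->.
by rewrite mul0rn.
Qed.

Lemma mulmx_entry (K : numFieldType) (k n l : nat) (A : 'M[K]_(k, n)) (B : 'M[K]_n)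
    (C : 'M[K]_(l, n)) i j :
  (A *m B *m C^T) i j = (row i A *m B *m (row j C)^T) 0 0.
Proof.
rewrite -row_mul mxE [RHS]mxE; apply: eq_bigr => x _.
by rewrite [row _ _ _ _]mxE [C^T _ _]mxE [(row _ _)^T _ _]mxE [row _ _ _ _]mxE.
Qed.

(** * Singular points of rank at most two fall into the charts *)

Section RankTwoSingularities.
Variables (K : numFieldType) (m d : nat).
Local Notation M := m.+2.
Local Notation n := M.+1.

(** Euler's identity for the partial derivatives, of degree [d - 1], identifies [p H] with [d - 1]
    times the gradient at [p]. *)
Lemma hessian_mul_singular (F : dhomog n K d) (p : 'rV[K]_n) :
  (forall i, ((F : {mpoly K[n]})^`M(i)).@[p 0] = 0) -> p *m hessian F p = 0.
Proof.
move=> dF; apply/rowP => j; rewrite !mxE.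
under eq_bigr => i _ do rewrite mxE mderiv_comm.
rewrite (@euler_identity _ _ d.-1) ?dF ?mulr0 //.
by apply: dhomog_mderiv; apply: dhomog_is_dhomog.
Qed.

(** The left kernel has dimension at least [m]. Among [m] independent rows of it, an invertible
    minor is brought to the last [m] columns and normalised to the identity. *)
Lemma left_kernel_echelon (S : 'M[K]_M) : (\rank S <= 2)%N ->
  exists (s : {perm 'I_M}) (B : 'M[K]_(m, 2)),
    ((row_mx B 1%:M : 'M_(m, 2 + m)) *m perm_mx s) *m S = 0.
Proof.
move=> S2; pose r := \rank (kermx S).
have mr : (m <= r)%N by rewrite /r mxrank_ker; lia.
pose D : 'M[K]_(m, M) := (pid_mx m : 'M_(m, r)) *m row_base (kermx S).
have DS : D *m S = 0.
  by apply/sub_kermxP; rewrite (submx_trans (submxMl _ _)) // (eq_row_base (kermx S)).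
have Dfull : row_full D^T.
  rewrite /row_full mxrank_tr mxrankMfree ?row_base_free // rank_pid_mx //.
have [s sE] := @perm_extend m 'I_M (@rshift 2 m) (fullrankfun Dfull)
  (@rshift_inj 2 m) (@fullrankfun_inj _ _ _ _ Dfull).
pose Q := colsub (fullrankfun Dfull) D.
have Qu : Q \in unitmx.
  rewrite -unitmx_tr (_ : Q^T = rowsub (fullrankfun Dfull) D^T) ?fullrowsub_unit //.
  by apply/matrixP => i j; rewrite !mxE.
exists s, (\matrix_(a < m, b < 2) (invmx Q *m D) a (s (lshift m b))).
suff -> : row_mx (\matrix_(a < m, b < 2) (invmx Q *m D) a (s (lshift m b))) 1%:M *m perm_mx s =
    invmx Q *m D :> 'M_(m, M).
  by rewrite -mulmxA DS mulmx0.
rewrite -[s in perm_mx s]invgK -col_permE; apply/matrixP => a c; rewrite mxE /row_mx mxE.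
rewrite -[c in RHS](permKV s); case: fintype.splitP => b bE.
  by rewrite mxE; congr ((_ *m _) _ (s _)); apply: val_inj.
have -> : (s^-1)%g c = rshift 2 b by apply: val_inj.
rewrite sE -[LHS]/((1%:M : 'M[K]_m) a b) -(mulVmx Qu) !mxE; apply: eq_bigr => k _.
by rewrite !mxE.
Qed.

(** The parameters are the coordinates of the point, scaled so that the [h]-th is 1, and the echelon
    form of the kernel of [S], the Hessian restricted to [x_h = 0]. Its rank is at most 2 by
    [quadratic_singularity_rank_geI]. *)
Lemma rank_two_singularity (W : hypersurface K M d) (F : dhomog n K d)
    (o : projective_space K M) :
  F \in line_of W -> F != 0 -> singular_locus W o ->
  ~ quadratic_singularity_rank_ge W o 3 -> exists h s, rank_two_chart h s F.
Proof.
move=> FW F0 sing nrank.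
have [v v0 oE] := proj_gen o; have [h vh] := rV0Pn _ v0.
pose p := (v 0 h)^-1 *: v.
have ph : p 0 h = 1 by rewrite mxE mulVf.
have po : p \in line_of o by rewrite oE memvZ // memv_line.
pose U : 'M[K]_(M, n) := unit_rows K h; pose H := hessian F p; pose S := U *m H *m U^T.
have pH : p *m H = 0 by apply: hessian_mul_singular => i; case: (sing F FW p po).
have Hp : H *m p^T = 0.
  by apply: trmx_inj; rewrite trmx_mul trmxK hessian_sym pH trmx0.
have S_sym : S^T = S by rewrite /S !trmx_mul trmxK hessian_sym mulmxA.
have S2 : (\rank S <= 2)%N.
  rewrite leqNgt; apply/negP => S3; apply: nrank.
  apply: (@quadratic_singularity_rank_geI _ _ _ _ _ F (frame p 1%:M h)) => //.
  - by rewrite frame_unit ?unitmx1 // ph oner_neq0.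
  - by rewrite row_frame0.
  by rewrite row_frame0 row'_frame0 mul1mx.
have [s [B BS]] := left_kernel_echelon S2.
exists h, s.
pose t (i : 'I_M + 'I_m * 'I_2) := match i with inl k => p 0 (lift h k) | inr (a, b) => B a b end.
have pE : chart_point h t = p.
  by apply/rowP => j; rewrite mxE; case: unliftP => [k|] -> //=.
exists t => j; rewrite /hessian_condition pE -/H mulmx_entry.
set e := chart_frame h s t.
have row0 : row ord0 e = p by rewrite row_frame0 pE.
have rowS k : row (lift ord0 k) e = row k (chart_block t *m perm_mx s *m U).
  by rewrite -(row'_frame0 (chart_point h t)); apply/rowP => l; rewrite !mxE.
(* Positions with [x = 0] vanish because [p H = 0]. Otherwise [y >= 3], and row [y] of the frame
   comes from an echelon row killed by [S], while row [x] also lies in [x_h = 0]. *)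
case: j => -[x y] /= /andP[xy nxy].
case: (unliftP ord0 x) => [x'|] Ex; last by rewrite Ex row0 pH mul0mx mxE.
have y2 : (2 < y)%N by move: nxy; rewrite Ex /= ltnNge.
case: (unliftP ord0 y) => [y'|] Ey; last by rewrite Ey in y2.
rewrite Ex Ey !rowS !row_mul trmx_mul.
have [b by'] : exists b : 'I_m, y' = rshift 2 b.
  have y'm : (y' - 2 < m)%N by have := ltn_ord y'; move: y2; rewrite Ey /= /bump /=; lia.
  by exists (Ordinal y'm); apply: val_inj; move: y2; rewrite Ey /= /bump /=; lia.
have rowb : row y' (chart_block t) = row b (row_mx B 1%:M : 'M_(m, 2 + m)).
  apply/rowP => k; rewrite [LHS]mxE [RHS]mxE by' /chart_block.
  rewrite (_ : \matrix_(_, _) _ = B); last by apply/matrixP => ? ?; rewrite mxE.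
  exact: (col_mxEd (row_mx 1%:M 0) (row_mx B 1%:M)).
set c := row x' _ *m _; rewrite -(mulmxA c U H) -(mulmxA c) (mulmxA (U *m H)) -/S.
rewrite -{1}S_sym -trmx_mul rowb -row_mul -row_mul BS.
by rewrite linear0 trmx0 mulmx0 mxE.
Qed.

End RankTwoSingularities.

(** * Points in general position *)

Section GeneralPosition.
Variables (K : numFieldType) (V : vectType K).
Implicit Types (S : set (proj V)) (U : {vspace V}) (X G : seq V) (x y : V).

Definition points_in S U : set (proj V) := [set o | S o /\ (line_of o <= U)%VS].

(** Any at most [k + 1] distinct members are linearly independent; the form with spans is the one
    that yields separating hyperplanes. *)
Definition general_position (k : nat) X : Prop :=
  forall x G, x \in X -> {subset G <= X} -> x \notin G -> (size G <= k)%N ->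
  x \notin <<G>>%VS.

Lemma finite_points_in_line S U : (\dim U <= 1)%N -> finite_set (points_in S U).
Proof.
move=> dU; have [ne|/nonemptyPn ->] := pselect (points_in S U !=set0); last exact: finite_set0.
case: ne => o [_ oU]; apply: sub_finite_set (finite_set1 o) => o' [_ o'U].
have eqU (L : proj V) : (line_of L <= U)%VS -> line_of L = U.
  move=> LU; apply/eqP; rewrite eqEdim LU /=.
  by case: L LU => L /= /eqP ->.
apply: val_inj; exact: etrans (eqU _ o'U) (esym (eqU _ oU)).
Qed.

Lemma minimal_infinite_subspace S : ~ finite_set S ->
  exists k U, [/\ (0 < k)%N, \dim U = k.+1, ~ finite_set (points_in S U) &
    forall U', (\dim U' <= k)%N -> finite_set (points_in S U')].
Proof.
move=> infS.
pose p r := `[< exists U, \dim U = r /\ ~ finite_set (points_in S U) >].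
have exp : exists r, p r.
  exists (\dim {:V}); apply/asboolP; exists fullv; split=> // fin; apply: infS.
  by apply: sub_finite_set fin => o So; split=> //; apply: subvf.
case: (ex_minnP exp) => r /asboolP[U [dU infU]] minr.
have r1 : (1 < r)%N.
  by rewrite ltnNge; apply/negP => r1; apply/infU/finite_points_in_line; rewrite dU.
exists r.-1, U; split=> //; try by lia.
move=> U' dU'; apply: contrapT => infU'.
have /minr : p (\dim U') by apply/asboolP; exists U'.
lia.
Qed.

(** Exchange argument: if [y] lies in the span of [x] and [G'], the coefficient of [x] is nonzero by
    general position of [X], so [x] lies in the span of [y] and [G'], which [newx] forbids. *)
Lemma general_position_rcons k X x : (0 < k)%N -> general_position k X ->
  (forall G, {subset G <= X} -> (size G <= k)%N -> x \notin <<G>>%VS) ->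
  general_position k (x :: X).
Proof.
move=> k0 gpX newx y G; rewrite inE => yX GX yG Gk.
have [xG|xG] := boolP (x \in G); last first.
  have GX' : {subset G <= X}.
    move=> z zG; have := GX z zG; rewrite inE => /predU1P[E|//].
    by rewrite -E zG in xG.
  have [->|yx] := eqVneq y x; first exact: newx.
  by move: yX; rewrite (negPf yx) => /= yX; apply: gpX.
have yx : y != x by apply: contraNneq yG => ->.
move: yX; rewrite (negPf yx) => /= yX.
pose G' := [seq z <- G | z != x].
have G'X : {subset G' <= X}.
  move=> z; rewrite mem_filter => /andP[zx /GX]; by rewrite inE (negPf zx).
have G'k : (size G' < k)%N.
  apply: leq_trans Gk; rewrite size_filter -[ltnRHS](count_predC (predC1 x)).
  rewrite -[ltnLHS]addn0 ltn_add2l.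
  by rewrite -has_count; apply/hasP; exists x; rewrite //= eqxx.
apply/negP => yspan.
have : y \in (<[x]> + <<G'>>)%VS.
  apply: (subvP (_ : (<<G>> <= _)%VS)) yspan; apply/span_subvP => z zG; have [->|zx] := eqVneq z x.
    by apply: (subvP (addvSl _ _)); apply: memv_line.
  by apply: (subvP (addvSr _ _)); apply: memv_span; rewrite mem_filter zx.
case/memv_addP => _ /vlineP[a ->] [g gG' yE].
have yG' : y \notin <<G'>>%VS.
  by apply: gpX => //; [apply: contra yG; rewrite mem_filter => /andP[] | apply: ltnW].
have a0 : a != 0 by apply: contraNneq yG' => a0; rewrite yE a0 scale0r add0r.
have := newx (y :: G'); rewrite /= => /(_ _ G'k)/negP; apply.
  by move=> z; rewrite inE => /predU1P[->|/G'X].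
rewrite -[x](scalerK a0) (_ : a *: x = y - g); last by rewrite yE addrK.
rewrite memvZ // memvB //; first by rewrite memv_span // mem_head.
by apply: (subvP (_ : (<<G'>> <= _)%VS)) gG'; apply: sub_span => z zG'; rewrite inE zG' orbT.
Qed.

(** The spans of at most [k] of the vectors already found have dimension at most [k], so together
    they contain finitely many points of [S]; infinitely many are available in [U]. *)
Lemma general_position_exists S k U : (0 < k)%N -> \dim U = k.+1 ->
  ~ finite_set (points_in S U) ->
  (forall U', (\dim U' <= k)%N -> finite_set (points_in S U')) ->
  forall N, exists X, [/\ size X = N, uniq X, general_position k X &
    forall x, x \in X -> x \in U /\ cone S x].
Proof.
move=> k0 dU infU fin; elim=> [|N [X [sX uX gpX XU]]].
  by exists [::]; split=> // x G.
(* Boolean masks enumerate the subsequences of [X], which makes the union visibly finite. *)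
pose bad := \bigcup_(b in [set: (size X).-tuple bool])
  (if (size (mask b X) <= k)%N then points_in S <<mask b X>> else set0).
have fbad : finite_set bad.
  apply: bigcup_finite => // b _; case: ifP => // bk; apply: fin.
  exact: leq_trans (dim_span _) bk.
have [o [[So oU] nbad]] : exists o, points_in S U o /\ ~ bad o.
  apply: contrapT => no; apply: infU; apply: sub_finite_set fbad => o oSU.
  by apply: contrapT => nb; apply: no; exists o.
have [x x0 oE] := proj_gen o.
have newx G : {subset G <= X} -> (size G <= k)%N -> x \notin <<G>>%VS.
  move=> GX Gk; apply/negP => xG; apply: nbad.
  pose b := map_tuple (mem G) (in_tuple X).
  exists b => //=; rewrite -filter_mask.
  have -> : (size [seq y <- X | y \in G] <= k)%N.
    apply: leq_trans Gk; apply: uniq_leq_size; first exact: filter_uniq.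
    by move=> y; rewrite mem_filter => /andP[].
  split=> //; rewrite oE -memvE; apply: (subvP (_ : (<<G>> <= _)%VS)) xG; apply: sub_span => y yG.
  by rewrite mem_filter; apply/andP; split=> //; apply: GX.
exists (x :: X); split=> /=; first by rewrite sX.
- rewrite uX andbT; apply/negP => xX.
  have := newx [:: x]; rewrite /= => /(_ _ k0)/negP; apply.
    by move=> y; rewrite inE => /eqP ->.
  by rewrite memv_span ?mem_head.
- exact: general_position_rcons.
move=> y; rewrite inE => /predU1P[->|/XU//]; split.
  by rewrite memvE -oE.
by exists o; rewrite // oE memv_line.
Qed.

End GeneralPosition.

(** * Independence of double point conditions *)

Lemma mulmx_col (K : numFieldType) (l m n : nat) (A : 'M[K]_(l, m)) (B : 'M[K]_(m, n)) j :
  A *m col j B = col j (A *m B).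
Proof. by rewrite !colE mulmxA. Qed.

(** The columns of [cokermx A] vanish on [G]; one of them is nonzero at [v], which is outside the
    row space of [A], and is rescaled. *)
Lemma separating_form (K : numFieldType) n (v : 'rV[K]_n) (G : seq 'rV[K]_n) :
  v \notin <<G>>%VS ->
  exists a : 'cV[K]_n, (v *m a) 0 0 = 1 /\ forall w, w \in G -> w *m a = 0.
Proof.
move=> vG; pose A : 'M[K]_(size G, n) := \matrix_i G`_i.
have vA : v *m cokermx A != 0.
  apply: contra vG; rewrite -submxE => /submxP[u ->].
  rewrite mulmx_sum_row; apply: memv_suml => i _; rewrite memvZ // rowK.
  by apply: memv_span; apply: mem_nth.
have [j vj] := rV0Pn _ vA.
exists (((v *m cokermx A) 0 j)^-1 *: col j (cokermx A)); split.
  by rewrite -scalemxAr mxE mulmx_col [col _ _ _ _]mxE mulVf.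
move=> w wG; rewrite -scalemxAr mulmx_col.
have -> : w = row (Ordinal (etrans (index_mem w G) wG)) A by rewrite rowK nth_index.
by rewrite -row_mul mulmx_coker !linear0.
Qed.

Section DoublePoints.
Variables (K : numFieldType) (M k q : nat) (P : finType).
Local Notation n := M.+1.
Local Notation d := (2 * q.+1)%N.
Hypotheses (k_gt0 : (0 < k)%N) (cardP : (#|P| <= k * q)%N).
Implicit Types (x : P -> 'rV[K]_n) (i j : P) (f g : {mpoly K[n]}).

Definition in_general_position x : Prop := forall j (G : seq P), j \notin G ->
  (size G <= k)%N -> x j \notin <<map x G>>%VS.

Definition deriv_along (c y : 'rV[K]_n) f : K := \sum_i c 0 i * (f^`M(i)).@[y 0].

Lemma deriv_alongM c y f g :
  deriv_along c y (f * g) = deriv_along c y f * g.@[y 0] + f.@[y 0] * deriv_along c y g.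
Proof.
rewrite /deriv_along mulr_suml mulr_sumr -big_split; apply: eq_bigr => i _ /=.
by rewrite mderivM mevalD !mevalM; ring.
Qed.

Lemma deriv_along_linear_form c y (a : 'cV[K]_n) :
  deriv_along c y (linear_form a) = (c *m a) 0 0.
Proof.
by rewrite mxE; apply: eq_bigr => i _; rewrite mderiv_linear_form mevalC.
Qed.

(* A double point condition at [x j] is tested on [g ^ 2 * h * l], where g is a
   product of linear forms, one for each of q groups of at most k points, that
   vanishes at the points other than [x j]. *)
Lemma double_points_independent x : in_general_position x ->
  forall c : P -> 'rV[K]_n,
  (forall F : dhomog n K d, \sum_j deriv_along (c j) (x j) F = 0) -> forall j, c j = 0.
Proof.
move=> gpx c c0 j.
(* The points are numbered and cut into [q] consecutive blocks of length at most [k]. *)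
pose grp i := (enum_rank i %/ k)%N.
have grp_lt i : (grp i < q)%N.
  by rewrite ltn_divLR // mulnC (leq_trans (ltn_ord _)) // mulnC.
pose G (b : 'I_q) := [seq i <- enum P | (i != j) && (grp i == b)].
have Gk b : (size (G b) <= k)%N.
  rewrite -(size_map (fun i => enum_rank i %% k)%N) -[leqRHS](size_iota 0 k).
  apply: uniq_leq_size => [|y /mapP[i _ ->]]; last by rewrite mem_iota add0n ltn_mod.
  rewrite map_inj_in_uniq; first by apply: filter_uniq; apply: enum_uniq.
  move=> i i'.
  rewrite !mem_filter => /andP[/andP[_ /eqP gi] _] /andP[/andP[_ /eqP gi'] _] E.
  apply: enum_rank_inj; apply: val_inj => /=.
  by rewrite (divn_eq (enum_rank i) k) (divn_eq (enum_rank i') k) -!/(grp _) gi gi' E.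
have /choice[a aP] : forall b : 'I_q, exists a : 'cV[K]_n,
    (x j *m a) 0 0 = 1 /\ forall w, w \in map x (G b) -> w *m a = 0.
  by move=> b; apply: separating_form; apply: gpx => //; rewrite mem_filter eqxx.
have [h [h1 _]] := separating_form (gpx j [::] isT (leq0n k)).
pose g := \prod_b linear_form (a b) ^+ 2.
have gj : g.@[x j 0] = 1.
  rewrite rmorph_prod big1 // => b _ /=.
  by rewrite rmorphXn /= meval_linear_form (proj1 (aP b)) expr1n.
(* The form of the group of [x i] occurs squared in [g], so [g * f] is singular at [x i]. *)
have gi i f : i != j -> forall c, deriv_along c (x i) (g * f) = 0.
  move=> ij c'; rewrite /g (bigD1 (Ordinal (grp_lt i))) //= expr2 -!mulrA.
  have l0 : (linear_form (a (Ordinal (grp_lt i)))).@[x i 0] = 0.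
    rewrite meval_linear_form (proj2 (aP _)) ?mxE //; apply: map_f.
    by rewrite mem_filter ij mem_enum /= eqxx.
  by rewrite deriv_alongM [_.@[_]]mevalM l0 !mul0r mulr0 addr0.
have gD : g \is (2 * q).-homog.
  rewrite /g -big_enum -[X in (2 * X)%N](size_enum_ord q).
  elim: (enum _) => [|b s IHs]; first by rewrite big_nil dhomog1.
  rewrite big_cons /= mulnS; apply: dhomogM => //.
  by rewrite -[2%N]mul1n; apply: dhomogMn; apply: linear_form_homog.
have test l : deriv_along (c j) (x j) (g * (linear_form h * linear_form l)) = 0.
  have FP : g * (linear_form h * linear_form l) \is d.-homog.
    rewrite mulnS addnC; apply: dhomogM => //.
    by apply: (@dhomogM _ _ _ 1 _ 1); apply: linear_form_homog.
  by have := c0 (DHomog FP); rewrite (bigD1 j) //= big1 ?addr0 // => i ij; rewrite gi.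
(* Testing with all linear forms [l] that vanish at [x j] leaves only multiples of [x j] for
   [c j]. *)
have cx : (c j <= x j)%MS.
  rewrite submxE; apply/eqP/rowP => y; rewrite [RHS]mxE.
  pose l := col y (cokermx (x j)).
  have xl : (x j *m l) 0 0 = 0 by rewrite mulmx_col mulmx_coker !mxE.
  have := test l; rewrite !deriv_alongM mevalM !meval_linear_form xl h1 gj.
  rewrite !mulr0 !mul1r add0r deriv_along_linear_form add0r => E.
  by rewrite -[RHS]E /l mulmx_col [RHS]mxE.
case/sub_rVP: cx => mu cE.
(* With [l = h] the test form has value 1 at [x j], and Euler's identity turns the condition into
   [mu * d = 0]. *)
suff mu0 : mu = 0 by rewrite cE mu0 scale0r.
have FP : g * (linear_form h * linear_form h) \is d.-homog.
  rewrite mulnS addnC; apply: dhomogM => //.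
  by apply: (@dhomogM _ _ _ 1 _ 1); apply: linear_form_homog.
have /eqP := test h; rewrite /deriv_along cE.
under eq_bigr => i _ do rewrite mxE -mulrA.
rewrite -mulr_sumr (euler_identity _ FP) !mevalM gj meval_linear_form h1 !mulr1.
by rewrite mulf_eq0 Num.Theory.pnatr_eq0 muln_eq0 orbF => /eqP.
Qed.

End DoublePoints.

Lemma general_position_free (K : numFieldType) (V : vectType K) k (X G : seq V) :
  general_position k X -> {subset G <= X} -> uniq G -> (size G <= k.+1)%N -> free G.
Proof.
move=> gpX; elim: G => [|x G IHG] GX; first by rewrite nil_free.
rewrite /= => /andP[xG uG] Gk; have G'X : {subset G <= X}.
  by move=> y yG; apply: GX; rewrite inE yG orbT.
rewrite free_cons IHG ?andbT //; last exact: ltnW.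
by apply: gpX => //; apply: GX; apply: mem_head.
Qed.

Section DoublePointLocus.
Variables (K : numFieldType) (M q k r : nat).
Local Notation n := M.+1.
Local Notation d := (2 * q.+1)%N.
Local Notation P := ('I_k.+1 + 'I_r)%type.
Local Notation I := ('I_k.+1 * 'I_n + 'I_r * 'I_k)%type.
Hypotheses (k_gt0 : (0 < k)%N) (krq : (k.+1 + r <= k * q)%N).
Implicit Types (t : I -> K) (j : P * 'I_n) (F : dhomog n K d).

Definition base_point t (a : 'I_k.+1) : 'rV[K]_n := \row_i t (inl (a, i)).

(* In general position the coefficient of the first base point is nonzero, and it
   is normalised to 1: each of these points has only k parameters. *)
Definition spanned_point t (p : P) : 'rV[K]_n :=
  match p with
  | inl a => base_point t a
  | inr b => base_point t ord0 + \sum_(i < k) t (inr (b, i)) *: base_point t (lift ord0 i)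
  end.

Definition gradient_condition j t F : K :=
  ((F : {mpoly K[n]})^`M(j.2)).@[spanned_point t j.1 0].

Definition double_point_locus : set (dhomog n K d) :=
  [set F | exists t, in_general_position k (spanned_point t) /\
    forall j, gradient_condition j t F = 0].

Lemma polyfun_base_point a i : polyfun (fun t => base_point t a 0 i).
Proof. by apply: polyfun_ext (polyfun_var K (inl (a, i))) => t; rewrite mxE. Qed.

Lemma polyfun_spanned_point p i : polyfun (fun t => spanned_point t p 0 i).
Proof.
case: p => [a|b] /=; first exact: polyfun_base_point.
apply: polyfun_ext (_ : polyfun (fun t => base_point t ord0 0 i +
    \sum_(l < k) t (inr (b, l)) * base_point t (lift ord0 l) 0 i)) => [t|].
  by rewrite mxE summxE; congr (_ + _); apply: eq_bigr => l _; rewrite mxE.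
apply: polyfunD; first exact: polyfun_base_point.
apply: polyfun_sum => l; apply: polyfunM; last exact: polyfun_base_point.
exact: polyfun_var.
Qed.

(** A base point has as many parameters as it imposes conditions; the codimension comes from the [r]
    other points, each with [n] conditions and [k] parameters. *)
Lemma codim_double_point_locus c :
  (c + (k.+1 * n + r * k) <= (k.+1 + r) * n)%N -> codim_ge_alg double_point_locus c.
Proof.
move=> cE.
have Llin j t (a : K) u v : gradient_condition j t (a *: u + v) =
    a * gradient_condition j t u + gradient_condition j t v.
  by rewrite /gradient_condition /= mderivD mderivZ mevalD mevalZ.
have Lpoly j F : polyfun (fun t => gradient_condition j t F).
  by apply: polyfun_meval => i; apply: polyfun_spanned_point.
apply: codim_ge_alg_sub (codim_ge_alg_linear_conditions (c := c) Llin Lpoly _); last first.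
  by rewrite card_sum !card_prod card_sum !card_ord.
move=> F [t [gpt Ft]]; exists t; split=> // c' c0 [p i].
have cardP : (#|{: P}| <= k * q)%N by rewrite card_sum !card_ord.
have := double_points_independent k_gt0 cardP gpt (c := fun p => \row_i c' (p, i)).
move=> /(_ _ p)/rowP/(_ i); rewrite !mxE; apply => G.
rewrite -[RHS](c0 G).
rewrite [RHS](eq_bigr (fun j => c' (j.1, j.2) * gradient_condition (j.1, j.2) t G)); last by case.
rewrite -(pair_bigA _ (fun p i => c' (p, i) * gradient_condition (p, i) t G)) /=.
by apply: eq_bigr => p' _; apply: eq_bigr => i' _; rewrite mxE.
Qed.

End DoublePointLocus.

(** * From infinitely many singular points to double points in general position *)

Section InfiniteSingularLocus.
Variables (K : numFieldType) (M q : nat).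
Local Notation n := M.+1.
Local Notation d := (2 * q.+1)%N.

Lemma infinite_singular_locus (W : hypersurface K M d) (F : dhomog n K d) :
  F \in line_of W -> (2 <= q)%N -> ~ finite_set (singular_locus W) ->
  exists k : 'I_M, double_point_locus k.+1 (k.+1 * q - k.+2) F.
Proof.
move=> FW q2 inf; have [k [U [k0 dU infU fin]]] := minimal_infinite_subspace inf.
have kM : (k <= M)%N.
  by have := dimvS (subvf U); rewrite dU dimvf /dim /= mul1n ltnS.
(* From here [k] is shifted by one: [U] has projective dimension [k + 1], and [(k + 1) q] points are
   taken, the first [k + 2] as base points. *)
case: k k0 dU fin kM => // k k0 dU fin kM.
exists (Ordinal kM); rewrite /=; set r := (_ - _)%N.
have rE : (k.+2 + r = k.+1 * q)%N by rewrite /r subnKC //; nia.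
have [X [sX uX gpX XU]] := general_position_exists k0 dU infU fin (k.+2 + r).
pose idx (p : 'I_k.+2 + 'I_r) : nat := match p with inl a => a | inr b => (k.+2 + b)%N end.
have idx_lt p : (idx p < size X)%N.
  by rewrite sX; case: p => a /=; have := ltn_ord a; lia.
have idx_inj : injective idx.
  case=> [a|a] [b|b] /= E; first by congr inl; apply: val_inj.
  - by have := ltn_ord a; lia.
  - by have := ltn_ord b; lia.
  by congr inr; apply: val_inj; apply/eqP; rewrite -(eqn_add2l k.+2) E.
pose B := [tuple X`_i | i < k.+2].
have BX : {subset B <= X}.
  by move=> y /mapP[a _ ->]; apply: mem_nth; rewrite sX; have := ltn_ord a; lia.
have Xinj i j : (i < size X)%N -> (j < size X)%N -> X`_i = X`_j -> i = j.
  by move=> iX jX /eqP; rewrite nth_uniq // => /eqP.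
(* General position makes the base points independent, and their number is the dimension of [U]. *)
have BU : <<B>>%VS = U.
  apply/eqP; rewrite eqEdim dU; apply/andP; split.
    by apply/span_subvP => y /BX/XU[].
  have /eqP -> : free B; last by rewrite size_tuple.
  apply: general_position_free gpX BX _ _; last by rewrite size_tuple.
  rewrite map_inj_uniq ?enum_uniq // => a b /= E; apply: val_inj; apply: Xinj E.
    by rewrite sX; have := ltn_ord a; lia.
  by rewrite sX; have := ltn_ord b; lia.
pose y (b : 'I_r) := X`_(k.+2 + b).
pose g b i := coord B i (y b).
have yE b : y b = \sum_i g b i *: X`_i.
  have yB : y b \in <<B>>%VS.
    by rewrite BU; case: (XU (y b)) => //; apply: mem_nth (idx_lt (inr b)).
  rewrite {1}(coord_span yB); apply: eq_bigr => i _.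
  by rewrite -tnth_nth tnth_mktuple.
(* Otherwise [y b] would lie in the span of the [k + 1] base points other than the first, against
   general position. *)
have g0 b : g b ord0 != 0.
  apply/eqP => gb0; pose G := [seq X`_(lift ord0 i) | i : 'I_k.+1].
  have : y b \notin <<G>>%VS.
    apply: gpX; [exact: mem_nth (idx_lt (inr b))| | |by rewrite size_map size_enum_ord].
      by move=> z /mapP[i _ ->]; apply: mem_nth (idx_lt (inl (lift ord0 i))).
    apply/mapP => -[i _ /(Xinj _ _ (idx_lt (inr b)) (idx_lt (inl (lift ord0 i))))].
    by move=> /(idx_inj (inr b) (inl _)).
  move/negP; apply; rewrite yE big_ord_recl gb0 scale0r add0r.
  by apply: memv_suml => i _; rewrite memvZ // memv_span //; apply/mapP; exists i; rewrite ?mem_enum.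
(* Each further point is rescaled to have coefficient 1 on the first base point; the singularity
   conditions and general position are insensitive to scale. *)
pose t (x : 'I_k.+2 * 'I_n + 'I_r * 'I_k.+1) : K := match x with
  | inl (a, i) => X`_a 0 i
  | inr (b, i) => (g b ord0)^-1 * g b (lift ord0 i) end.
have baseE a : base_point t a = X`_a by apply/rowP => i; rewrite mxE.
have ptE p : exists2 mu, mu != 0 & spanned_point t p = mu *: X`_(idx p).
  case: p => [a|b] /=; first by exists 1; rewrite ?oner_neq0 // scale1r baseE.
  exists (g b ord0)^-1; rewrite ?invr_eq0 // -/(y b) yE [in RHS]big_ord_recl scalerDr scalerA.
  rewrite mulVf // scale1r baseE; congr (_ + _); rewrite scaler_sumr.
  by apply: eq_bigr => i _; rewrite baseE scalerA.
exists t; split.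
  move=> p G pG Gk; have [mu mu0 pE] := ptE p; rewrite pE.
  have : X`_(idx p) \notin <<[seq X`_(idx i) | i <- G]>>%VS.
    apply: gpX; [exact: mem_nth| | |by rewrite size_map].
      by move=> z /mapP[i _ ->]; apply: mem_nth.
    by apply/mapP => -[i iG /(Xinj _ _ (idx_lt p) (idx_lt i))/idx_inj E]; rewrite E iG in pG.
  apply: contra => pspan; rewrite -[X`_(idx p)](scalerK mu0) memvZ //.
  apply: (subvP (_ : (<<map (spanned_point t) G>> <= _)%VS)) pspan.
  apply/span_subvP => z /mapP[i iG ->]; have [nu _ ->] := ptE i.
  by rewrite memvZ // memv_span //; apply/mapP; exists i.
move=> [p i]; rewrite /gradient_condition /=.
have [mu _ ->] := ptE p; have [_ [o sing xo]] := XU _ (mem_nth 0 (idx_lt p)).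
by have [_ ->] := sing F FW (mu *: X`_(idx p)) (memvZ _ xo).
Qed.

End InfiniteSingularLocus.

(** * Stability under scaling, the numerical estimate and the regular locus *)

Lemma rank_two_chartZ (K : numFieldType) m d h s (a : K) (F : dhomog m.+3 K d) :
  rank_two_chart h s F -> rank_two_chart h s (a *: F).
Proof.
move=> [t Ft]; exists t => j.
have hE x : hessian (a *: F : dhomog m.+3 K d) x = a *: hessian F x.
  by apply/matrixP => i l; rewrite !mxE /= !mderivZ mevalZ.
rewrite /hessian_condition hE -scalemxAr -scalemxAl mxE.
by have := Ft j; rewrite /hessian_condition => ->; rewrite mulr0.
Qed.

Lemma double_point_locusZ (K : numFieldType) M q k r (a : K) (F : dhomog M.+1 K (2 * q.+1)) :
  double_point_locus k r F -> double_point_locus k r (a *: F).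
Proof.
move=> [t [gpt Ft]]; exists t; split=> // j.
by rewrite /gradient_condition /= mderivZ mevalZ -/(gradient_condition j t F) Ft mulr0.
Qed.

(** Here [k + 1] is the projective dimension of the span, [b] its codimension in the projective
    space, [k + b = M - 1], [r] counts the points beyond the base points, and [p + 1] is the
    required codimension. Equality occurs at [k = 0], [b = 3], which is where [M >= 4] enters. *)
Lemma double_point_count (k b r p : nat) : (3 <= k + b)%N ->
  (r + 2 = k * k + k * b + b)%N -> (p * 2 = (k + b) * (k + b - 1))%N ->
  (p + 1 <= r * b.+1)%N.
Proof.
move=> kb3 rE pE.
have [k0|k0] := posnP k; first by subst k; nia.
have [b0|b0] := posnP b; first by subst b; nia.
have kb : (k + b <= k * b + 1)%N by nia.
have : ((k + b) * (k + b - 1) <= (k + b) * (k * b))%N by rewrite leq_mul2l; lia.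
have : (r * b.+1 + 2 * b.+1 = (k * k + k * b + b) * b.+1)%N by rewrite -mulnDl rE.
have : ((k * k + k * b + b) * b.+1 = (k + b) * (k * b) + (k + b) * k + b * b + b)%N by lia.
have : (k + b <= (k + b) * k)%N by apply: leq_pmulr.
have : (b <= b * b)%N by apply: leq_pmulr.
lia.
Qed.

Lemma regular_hypersurfaces (K : numFieldType) (m : nat) (m_ge2 : (2 <= m)%N) :
  exists Wreg : set (hypersurface K m.+2 (2 * m.+2)),
    [/\ zariski_open Wreg,
        forall W, Wreg W -> finite_set (singular_locus W) /\
          (forall o, singular_locus W o -> quadratic_singularity_rank_ge W o 3) &
        codim_ge (~` Wreg) (m * m.+1 %/ 2 + 1)].
Proof.
pose V : vectType K := dhomog m.+3 K (2 * m.+2).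
pose B1 : set V := [set F | exists x : 'I_m.+3 * {perm 'I_m.+2}, rank_two_chart x.1 x.2 F].
pose B2 : set V := [set F | exists k : 'I_m.+2,
  double_point_locus k.+1 (k.+1 * m.+1 - k.+2) F].
pose B : set V := B1 `|` B2.
have Bcodim : codim_ge_alg B (m * m.+1 %/ 2 + 1).
  apply: codim_ge_algU; [apply: codim_ge_alg_bigcup => -[h s] | apply: codim_ge_alg_bigcup => k].
    by apply: codim_rank_two_chart; lia.
  have krq : (k.+2 <= k.+1 * m.+1)%N by nia.
  apply: codim_double_point_locus => //; first by rewrite subnKC.
  set r := (_ - _)%N; pose b := (m.+1 - k)%N; have km := ltn_ord k.
  (* Each of the [r] further points contributes [m.+3 - k.+1 = b.+1] to the codimension. *)
  suff : (m * m.+1 %/ 2 + 1 <= r * b.+1)%N.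
    have -> : m.+3 = (b.+1 + k.+1)%N by rewrite /b; lia.
    by rewrite !mulnDr !mulnDl; lia.
  have mE : (k + b = m.+1)%N by rewrite /b; lia.
  apply: (@double_point_count k); first by lia.
    have : (r + k.+2 = k.+1 * (k + b))%N by rewrite mE subnK.
    by rewrite mulSn mulnDr; lia.
  have := divn_eq (m * m.+1) 2; rewrite modn2 oddM /= andbN addn0 => <-.
  by rewrite mE subn1 mulnC.
(* Since [B] is a cone, one generator of [W] in [B] already puts the whole line [W] into the
   closure. *)
have BZ a F : B F -> B (a *: F).
  case=> [[x Fx]|[k Fk]]; [left; exists x | right; exists k].
    exact: rank_two_chartZ.
  exact: double_point_locusZ.
exists (~` zero_locus [set f | vanishes_on B f]); split.
- rewrite /zariski_open setCK; exact: zariski_closed_zero_locus.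
- move=> W WB; have [F F0 WF] := proj_gen W.
  have FW : F \in line_of W by rewrite WF memv_line.
  have nB : ~ B F.
    move=> BF; apply: WB => f fB v; rewrite WF => /vlineP[a ->].
    exact: fB (BZ _ _ BF).
  split.
    apply: contrapT => /(infinite_singular_locus FW (ltnW m_ge2 : (1 < m.+1)%N))[k Fk].
    by apply: nB; right; exists k.
  move=> o So; apply: contrapT => /(rank_two_singularity FW F0 So)[h [s Fhs]].
  by apply: nB; left; exists (h, s).
rewrite setCK; exact: codim_ge_closure.
Qed.

Theorem theorem0p4 (R : realType) (M : nat) (hM : (4 <= M)%N) :
  exists Wreg : set (hypersurface R[i] M (2 * M)),
    [/\ zariski_open Wreg,
        forall W : hypersurface R[i] M (2 * M), Wreg W ->
          finite_set (singular_locus W) /\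
          (forall o : projective_space R[i] M, singular_locus W o ->
             quadratic_singularity_rank_ge W o 3) &
        codim_ge (~` Wreg) (((M - 2) * (M - 1)) %/ 2 + 1)%N].
Proof.
case: M hM => [|[|m]] // hM; rewrite [(m.+2 - 2)%N]subSS subn1 subSS subn0 /=.
exact: (@regular_hypersurfaces R[i] m).
Qed.
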